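(* Let $A$ be a Noetherian one-dimensional domain of prime characteristic $p$ which is either (a) a complete local domain $(A,\mathfrak m,k)$, or (b) an $\mathbb N$-graded domain $A=\bigoplus_{i\ge 0}A_i$ with $\mathfrak m=\bigoplus_{i>0}A_i$ and $A_0\cong A/\mathfrak m=k$ a field. Assume that $k$ is algebraically closed. Let $M$ be a finitely generated $A$-module, assumed graded in case (b). Let $B$ be the integral closure of $A$ (in its field of fractions), let $r$ be the rank of $M$, and let $\ell$ be the length of $H^0_{\mathfrak m}(M)$. Then for all sufficiently large $e$, writing $q=p^e$, there is an isomorphism of $A$-modules $$ {}^eM\cong B^{\oplus rq}\oplus k^{\ell}. $$ In particular, $M$ has finite F-representation type.
   Context: All rings are commutative Noetherian of prime characteristic $p$; $\mathbb N=\{0,1,2,\dots\}$. For an $\mathbb N$-graded ring $A=\bigoplus_{i\ge0}A_i$ it is assumed that $\gcd\{i\mid A_i\ne 0\}=1$. For an $A$-module $M$ and $e\in\mathbb N$, ${}^eM$ denotes the $A$-module which equals $M$ as an abelian group, with $A$-action $a\cdot m:=a^{p^e}m$. A finitely generated $A$-module $M$ has finite F-representation type if there are finitely many finitely generated $A$-modules $M_1,\dots,M_s$ such that for every $e\in\mathbb N$ there are nonnegative integers $n_{e,1},\dots,n_{e,s}$ with ${}^eM\cong\bigoplus_{i=1}^s M_i^{\oplus n_{e,i}}$ as $A$-modules. $H^0_{\mathfrak m}(M)=\{m\in M\mid \mathfrak m^n m=0 \text{ for some } n\}$. The rank of $M$ is $\dim_{\operatorname{Frac}(A)}(M\otimes_A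 \operatorname{Frac}(A))$. *)

(* Defs.v *)
From HB Require Import structures.
From mathcomp Require Import all_boot all_order all_algebra.
From mathcomp Require Import boolp.

Set Implicit Arguments.
Unset Strict Implicit.
Unset Printing Implicit Defensive.

Import GRing.Theory.
Local Open Scope ring_scope.

(* Ideals and submodules are boolean predicates.  Every Prop-valued predicate
   is reflected by one through boolp, so nothing is lost.  Ideals that may be
   improper are submodules of the regular module A^o; [idealr_closed] describes
   proper ideals. *)

Section Modules.
Variable R : pzRingType.

Definition lmod_iso (U V : lmodType R) : Prop :=
  exists f : {linear U -> V}, bijective f.

Definition fin_gen_sub (V : lmodType R) (S : {pred V}) : Prop :=
  exists (n : nat) (g : 'I_n -> V),
    forall x, x \in S <-> exists c : 'I_n -> R, x = \sum_(i < n) c i *: g i.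

Definition fin_gen (V : lmodType R) : Prop := fin_gen_sub (predT : {pred V}).

Definition proper_sub (T : Type) (S S' : {pred T}) : Prop :=
  {subset S <= S'} /\ ~ {subset S' <= S}.

(* S has a composition series of length n; by Jordan-Hoelder n is then the
   length of S. *)
Definition has_length (V : lmodType R) (S : {pred V}) (n : nat) : Prop :=
  exists C : nat -> {pred V},
    [/\ forall i, (i <= n)%N -> submod_closed (C i),
        C 0%N =i pred1 0,
        C n =i S &
        forall i, (i < n)%N ->
          proper_sub (C i) (C i.+1) /\
          forall N : {pred V}, submod_closed N ->
            {subset C i <= N} -> {subset N <= C i.+1} ->
            N =i C i \/ N =i C i.+1].

End Modules.

Definition restrict_scalars (R S : pzRingType) (f : {rmorphism R -> S})
  (N : lmodType S) : Type := N.

Section RestrictScalars.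
Variables (R S : pzRingType) (f : {rmorphism R -> S}) (N : lmodType S).
Local Notation T := (restrict_scalars f N).

HB.instance Definition _ := GRing.Zmodule.copy T N.

Definition restrict_scale (a : R) (x : T) : T := f a *: (x : N).

Fact restrict_scaleA a b v :
  restrict_scale a (restrict_scale b v) = restrict_scale (a * b) v.
Proof. by rewrite /restrict_scale rmorphM scalerA. Qed.
Fact restrict_scale1 : left_id 1 restrict_scale.
Proof. by move=> v; rewrite /restrict_scale rmorph1 scale1r. Qed.
Fact restrict_scaleDr : right_distributive restrict_scale +%R.
Proof. by move=> a u v; apply: scalerDr. Qed.
Fact restrict_scaleDl v : {morph restrict_scale^~ v : a b / a + b}.
Proof. by move=> a b; rewrite /restrict_scale rmorphD; apply: scalerDl. Qed.

HB.instance Definition _ := GRing.Zmodule_isLmodule.Build R T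
  restrict_scaleA restrict_scale1 restrict_scaleDr restrict_scaleDl.
End RestrictScalars.

Definition dirsum (R : pzRingType) (I : finType) (N : I -> lmodType R) : Type :=
  forall i, N i.

Section DirSum.
Variables (R : pzRingType) (I : finType) (N : I -> lmodType R).
Local Notation T := (dirsum N).

HB.instance Definition _ := Choice.copy T (forall i, N i).

Definition dirsum0 : T := fun i => 0.
Definition dirsum_opp (u : T) : T := fun i => - u i.
Definition dirsum_add (u v : T) : T := fun i => u i + v i.
Definition dirsum_scale (a : R) (u : T) : T := fun i => a *: u i.

Fact dirsum_addA : associative dirsum_add.
Proof. by move=> u v w; apply: functional_extensionality_dep => i; apply: addrA. Qed.
Fact dirsum_addC : commutative dirsum_add.
Proof. by move=> u v; apply: functional_extensionality_dep => i; apply: addrC. Qed.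
Fact dirsum_add0 : left_id dirsum0 dirsum_add.
Proof. by move=> u; apply: functional_extensionality_dep => i; apply: add0r. Qed.
Fact dirsum_addN : left_inverse dirsum0 dirsum_opp dirsum_add.
Proof. by move=> u; apply: functional_extensionality_dep => i; apply: addNr. Qed.
HB.instance Definition _ := GRing.isZmodule.Build T
  dirsum_addA dirsum_addC dirsum_add0 dirsum_addN.

Fact dirsum_scaleA a b (u : T) :
  dirsum_scale a (dirsum_scale b u) = dirsum_scale (a * b) u.
Proof. by apply: functional_extensionality_dep => i; apply: scalerA. Qed.
Fact dirsum_scale1 : left_id 1 dirsum_scale.
Proof. by move=> u; apply: functional_extensionality_dep => i; apply: scale1r. Qed.
Fact dirsum_scaleDr : right_distributive dirsum_scale +%R.
Proof. by move=> a u v; apply: functional_extensionality_dep => i; apply: scalerDr. Qed.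
Fact dirsum_scaleDl (u : T) : {morph dirsum_scale^~ u : a b / a + b}.
Proof. by move=> a b; apply: functional_extensionality_dep => i; apply: scalerDl. Qed.
HB.instance Definition _ := GRing.Zmodule_isLmodule.Build R T
  dirsum_scaleA dirsum_scale1 dirsum_scaleDr dirsum_scaleDl.
End DirSum.

Section Rings.
Variable A : comNzRingType.

Definition noetherian : Prop :=
  forall I : {pred A^o}, submod_closed I -> fin_gen_sub I.

Definition prime_ideal (P : {pred A}) : Prop :=
  idealr_closed P /\ prime_idealr_closed P.

Definition prime_chain (d : nat) (P : nat -> {pred A}) : Prop :=
  (forall i, (i <= d)%N -> prime_ideal (P i)) /\
  (forall i, (i < d)%N -> proper_sub (P i) (P i.+1)).

Definition krull_dim (d : nat) : Prop :=
  (exists P, prime_chain d P) /\ ~ (exists P, prime_chain d.+1 P).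

Definition maximal_ideal (m : {pred A}) : Prop :=
  idealr_closed m /\
  forall J : {pred A}, idealr_closed J -> {subset m <= J} -> J =i m.

Definition local_ring (m : {pred A}) : Prop :=
  maximal_ideal m /\ forall m', maximal_ideal m' -> m' =i m.

(* I ^ n; the coefficients c make the case n = 0 give the unit ideal. *)
Definition ideal_pow (I : {pred A}) (n : nat) : {pred A} := fun x =>
  `[< exists (N : nat) (c : 'I_N -> A) (f : 'I_N -> 'I_n -> A),
        (forall j i, f j i \in I) /\
        x = \sum_(j < N) c j * \prod_(i < n) f j i >].

(* The canonical map from A to the inverse limit of the A / m ^ n is bijective. *)
Definition adic_complete (m : {pred A}) : Prop :=
  (forall x : A, (forall n, x \in ideal_pow m n) -> x = 0) /\
  (forall u : nat -> A, (forall n, u n.+1 - u n \in ideal_pow m n) ->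
     exists y : A, forall n, y - u n \in ideal_pow m n).

Definition complete_local (m : {pred A}) : Prop :=
  local_ring m /\ adic_complete m.

(* pi identifies k with A / m. *)
Definition residue_field (m : {pred A}) (k : fieldType)
    (pi : {rmorphism A -> k}) : Prop :=
  (forall y, exists x, pi x = y) /\ (forall x, (x \in m) = (pi x == 0)).

(* H^0_m(M) *)
Definition H0 (m : {pred A}) (M : lmodType A) : {pred M} := fun x =>
  `[< exists n, forall a, a \in ideal_pow m n -> a *: x = 0 >].

(* V is the internal direct sum of the subgroups G i. *)
Definition is_grading (I : choiceType) (V : zmodType) (G : I -> {pred V}) : Prop :=
  [/\ forall i, zmod_closed (G i),
      forall x, exists (s : seq I) (f : I -> V),
        (forall i, f i \in G i) /\ x = \sum_(i <- s) f i &
      forall (s : seq I) (f : I -> V), uniq s -> (forall i, f i \in G i) ->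
        \sum_(i <- s) f i = 0 -> forall i, i \in s -> f i = 0].

(* N-graded, with gcd {i | G i != 0} = 1. *)
Definition graded_ring (G : nat -> {pred A}) : Prop :=
  [/\ is_grading G,
      1 \in G 0%N,
      forall i j x y, x \in G i -> y \in G j -> x * y \in G (i + j)%N &
      forall d, (forall i, (exists2 x, x \in G i & x != 0) -> (d %| i)%N) ->
        d = 1%N].

Definition irrelevant_ideal (G : nat -> {pred A}) : {pred A} := fun x =>
  `[< exists (s : seq nat) (f : nat -> A),
        [/\ forall i, i \in s -> (0 < i)%N,
            forall i, f i \in G i &
            x = \sum_(i <- s) f i] >].

(* Modules over an N-graded ring are Z-graded. *)
Definition graded_module (G : nat -> {pred A}) (M : lmodType A)
    (H : int -> {pred M}) : Prop :=
  is_grading H /\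
  forall i j a x, a \in G i -> x \in H j -> a *: x \in H (i%:Z + j).

(* T, with the pairing t, is the tensor product of M and N over A. *)
Definition is_tensor_product (M N : lmodType A) (T : zmodType)
    (t : M -> N -> T) : Prop :=
  let balanced (W : zmodType) (f : M -> N -> W) :=
    [/\ forall x x' y, f (x + x') y = f x y + f x' y,
        forall x y y', f x (y + y') = f x y + f x y' &
        forall a x y, f (a *: x) y = f x (a *: y)] in
  balanced T t /\
  forall (W : zmodType) (f : M -> N -> W), balanced W f ->
    (exists g : {additive T -> W}, forall x y, g (t x y) = f x y) /\
    (forall g g' : {additive T -> W},
       (forall x y, g (t x y) = g' (t x y)) -> g =1 g').

Definition frobenius_iter (p : nat) (pcharA : p \in [pchar A]) (e : nat) (a : A) : A :=
  a ^+ (p ^ e).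

Section FrobeniusIter.
Variables (p : nat) (pcharA : p \in [pchar A]) (e : nat).

Fact frobenius_iter_is_zmod_morphism : zmod_morphism (frobenius_iter pcharA e).
Proof.
rewrite /frobenius_iter; elim: e => [|n IHn] a b; first by rewrite !expr1.
rewrite expnSr !exprM IHn -!(pFrobenius_autE pcharA).
by rewrite pFrobenius_autB_comm //; apply: mulrC.
Qed.
Fact frobenius_iter_is_monoid_morphism : monoid_morphism (frobenius_iter pcharA e).
Proof. by split=> [|a b]; rewrite /frobenius_iter ?expr1n ?exprMn. Qed.
HB.instance Definition _ := GRing.isZmodMorphism.Build A A
  (frobenius_iter pcharA e) frobenius_iter_is_zmod_morphism.
HB.instance Definition _ := GRing.isMonoidMorphism.Build A A
  (frobenius_iter pcharA e) frobenius_iter_is_monoid_morphism.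
End FrobeniusIter.

(* ^e M : the group M with a . m := a ^ (p ^ e) m *)
Definition frobenius_module (p : nat) (pcharA : p \in [pchar A]) (e : nat)
    (M : lmodType A) : lmodType A :=
  restrict_scalars (frobenius_iter pcharA e) M.

Definition FFRT (p : nat) (pcharA : p \in [pchar A]) (M : lmodType A) : Prop :=
  exists (s : nat) (N : 'I_s -> lmodType A),
    (forall i, fin_gen (N i)) /\
    forall e : nat, exists n : 'I_s -> nat,
      lmod_iso (frobenius_module pcharA e M)
        (dirsum (fun i : 'I_s => ({ffun 'I_(n i) -> N i} : lmodType A))).

(* k = A / m as an A-module *)
Definition residue_module (k : fieldType) (pi : {rmorphism A -> k}) :
    lmodType A := restrict_scalars pi k^o.

End Rings.

Arguments H0 {A} m M _.

Fact integralOver_lincomb (R K : comNzRingType) (f : {rmorphism R -> K})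
    (a : R) (x y : K) :
  integralOver f x -> integralOver f y -> integralOver f (f a * x + y).
Proof.
move=> ix iy; apply: integral_add iy; apply: integral_mul ix.
exact: integral_id.
Qed.

Section Domains.
Variable A : idomainType.

Definition frac_module : lmodType A :=
  restrict_scalars (@FracField.tofrac A) {fraction A}^o.

(* r = dim_{Frac(A)} (M (x)_A Frac(A)); the Frac(A)-structure on the tensor
   product V is the one with c *: (x (x) y) = x (x) (c * y). *)
Definition has_rank (M : lmodType A) (r : nat) : Prop :=
  exists (V : vectType {fraction A}) (t : M -> frac_module -> V),
    [/\ is_tensor_product t,
        forall x (c y : {fraction A}), t x (c * y) = c *: t x y &
        \dim (fullv : {vspace V}) = r].

Definition integral_pred : {pred frac_module} := fun x =>
  `[< integralOver (@FracField.tofrac A) (x : {fraction A}) >].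

Fact integral_pred_submod_closed : submod_closed integral_pred.
Proof.
split=> [|a x y /asboolP ix /asboolP iy]; apply/asboolP.
  exact: (integral0 (@FracField.tofrac A)).
exact: (@integralOver_lincomb A {fraction A} (@FracField.tofrac A) a x y).
Qed.

(* The integral closure of A in Frac(A), as an A-module *)
Record integral_closure : predArgType := IntegralClosure {
  ic_val : frac_module;
  ic_valP : ic_val \in integral_pred }.

HB.instance Definition _ := [isSub for ic_val].
HB.instance Definition _ := [Choice of integral_closure by <:].
HB.instance Definition _ := GRing.SubChoice_isSubLmodule.Build
  A frac_module integral_pred integral_closure integral_pred_submod_closed.
End Domains.

(* Main.v *)
Require Import Defs.
From HB Require Import structures.
From mathcomp Require Import all_boot all_order all_algebra.
From mathcomp Require Import boolp.
From mathcomp Require Import zify ring.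

(** Write [q = p ^ e].  The idea is that for large [e] the Frobenius module is a
    module over the integral closure [B] of [A], and that [B] is a principal
    ideal domain with parameter [t], namely [k[[t]]] or [k[t]].

    Every [b] in [B] is [a + t b'] with [a] in [A], because the residue field
    [k] is algebraically closed, and [t ^ c B] lies in [A] for some [c].  So
    for [q >= c] the power [b ^ q = a ^ q + t ^ q b' ^ q] lies in [A], and
    [b |-> b ^ q] is a ring homomorphism [phi] from [B] to [A]
    ([frobenius_into]).  Restricting [M] along [phi] gives a finitely generated
    [B]-module whose restriction to [A] is the Frobenius module.  By Euclid's
    algorithm it is free modulo torsion ([free_mod_torsion]), hence the direct
    sum of a free module and its torsion.  The free part has rank [r q], because
    [B] is free over its [q]-th powers with basis [1, t, ..., t ^ (q - 1)]
    ([phi_rank]).  The torsion is [H0 m M], which [m] kills through [q]-th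
    powers for large [q]; since [k] is perfect it is a [k]-vector space of
    dimension [l] ([residue_basis]).

    The facts about [B] used here are collected in the record [uniformizer] and
    proved separately in the two cases.

    Complete case: fix a nonzero [x] in [m].  Akizuki's argument ([akizuki])
    shows that [B / x B] is finite over [A], so [B] is finite over the complete
    ring [A] by Nakayama's lemma, and a power of [x] lies in the conductor.
    Idempotents modulo the radical of [x B] lift to the domain [B]
    ([rad_idempotent]), so the quotient of [B] by this radical is local, and it
    equals [k] ([ic_residue]).  The radical is principal because [B] is
    integrally closed ([rad_principal]), so [B] is a discrete valuation ring.

    Graded case: a nonzero homogeneous [f] of positive degree has a quotient
    ring finite over [k], so multiplication by [f] is onto in large degrees.
    If [g] has the same degree, [g / f] acts on a finite-dimensional component,
    hence is an eigenvalue, hence lies in [k] ([component_dim1]).  Thus the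
    components of [A] have dimension at most one.  As the degrees have gcd [1],
    two consecutive degrees [n] and [n + 1] occur, and with [t] the quotient of
    elements of these degrees [A] is spanned by powers of [t], including all
    large ones.  So [B = k[t]] ([psi_surj]). *)

Set Implicit Arguments.
Unset Strict Implicit.
Unset Printing Implicit Defensive.

Import GRing.Theory.
Local Open Scope ring_scope.

(** * The integral closure as a domain *)

Lemma fracP (A : idomainType) (z : {fraction A}) :
  exists a b : A, b != 0 /\ z * FracField.tofrac b = FracField.tofrac a.
Proof.
elim/quotW: z => x.
exists (frac x).1, (frac x).2; split; first exact: denom_ratioP.
rewrite !piE.
apply/eqmodP; rewrite /= FracField.equivfE.
by rewrite /FracField.mulf !numden_Ratio ?mulr1 ?oner_neq0 ?denom_ratioP ?mulf_neq0 // mulrC.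
Qed.

Section IntegralClosureRing.
Variable A : idomainType.
Local Notation B := (integral_closure A).
Local Notation K := {fraction A}.
Local Notation frac := (@FracField.tofrac A).

Definition ic_frac (b : B) : K := ic_val b.
Arguments ic_frac : simpl never.

Lemma ic_frac_inj : injective ic_frac.
Proof. exact: val_inj. Qed.

Lemma ic_integral (b : B) : integralOver frac (ic_frac b).
Proof. by apply/asboolP; exact: (ic_valP b). Qed.

Definition ic_of (z : K) (iz : integralOver frac z) : B :=
  @IntegralClosure A z (introT (asboolP _) iz).

Definition ic_mul (b c : B) : B := ic_of (integral_mul (ic_integral b) (ic_integral c)).
Definition ic_one : B := ic_of (integral1 frac).

Fact ic_mulA : associative ic_mul.
Proof. by move=> x y z; apply: ic_frac_inj; apply: mulrA. Qed.
Fact ic_mulC : commutative ic_mul.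
Proof. by move=> x y; apply: ic_frac_inj; apply: mulrC. Qed.
Fact ic_mul1 : left_id ic_one ic_mul.
Proof. by move=> x; apply: ic_frac_inj; apply: mul1r. Qed.
Fact ic_mulDl : left_distributive ic_mul +%R.
Proof. by move=> x y z; apply: ic_frac_inj; apply: mulrDl. Qed.
Fact ic_one_neq0 : ic_one != 0.
Proof. by apply/eqP => /(congr1 ic_frac) /eqP; apply/negP; apply: oner_neq0. Qed.
HB.instance Definition _ := GRing.Zmodule_isComNzRing.Build B
  ic_mulA ic_mulC ic_mul1 ic_mulDl ic_one_neq0.

Definition ic_unit : {pred B} := fun b => `[< exists c, c * b = 1 >].
Definition ic_inv (b : B) : B :=
  if pselect (exists c, c * b = 1) is left h then projT1 (cid h) else b.
Fact ic_mulVr : {in ic_unit, left_inverse 1 ic_inv *%R}.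
Proof.
move=> b /asboolP h; rewrite /ic_inv; case: pselect => // h'.
exact: (projT2 (cid h')).
Qed.
Fact ic_unitP (b c : B) : c * b = 1 -> ic_unit b.
Proof. by move=> h; apply/asboolP; exists c. Qed.
Fact ic_inv_out : {in [predC ic_unit], ic_inv =1 id}.
Proof.
by move=> b; rewrite inE => /asboolP h; rewrite /ic_inv; case: pselect.
Qed.
HB.instance Definition _ := GRing.ComNzRing_hasMulInverse.Build B
  ic_mulVr ic_unitP ic_inv_out.

Fact ic_integral_domain (b c : B) : b * c = 0 -> (b == 0) || (c == 0).
Proof.
move=> /(congr1 ic_frac) /eqP h.
have : (ic_frac b * ic_frac c == 0) by [].
by rewrite mulf_eq0 => /orP[] /eqP e; apply/orP; [left|right]; apply/eqP;
  apply: ic_frac_inj.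
Qed.
HB.instance Definition _ := GRing.ComUnitRing_isIntegral.Build B ic_integral_domain.

Fact ic_frac_zmod : zmod_morphism ic_frac. Proof. by []. Qed.
Fact ic_frac_monoid : monoid_morphism ic_frac. Proof. by []. Qed.
HB.instance Definition _ := GRing.isZmodMorphism.Build B K ic_frac ic_frac_zmod.
HB.instance Definition _ := GRing.isMonoidMorphism.Build B K ic_frac ic_frac_monoid.

Definition to_ic (a : A) : B := ic_of (integral_id frac a).
Arguments to_ic : simpl never.
Lemma ic_frac_to a : ic_frac (to_ic a) = frac a. Proof. by []. Qed.
Fact to_ic_zmod : zmod_morphism to_ic.
Proof. by move=> a b; apply: ic_frac_inj; rewrite rmorphB !ic_frac_to rmorphB. Qed.
Fact to_ic_monoid : monoid_morphism to_ic.
Proof.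
split=> [|a b]; apply: ic_frac_inj; first by rewrite ic_frac_to !rmorph1.
by rewrite rmorphM /= !ic_frac_to rmorphM.
Qed.
HB.instance Definition _ := GRing.isZmodMorphism.Build A B to_ic to_ic_zmod.
HB.instance Definition _ := GRing.isMonoidMorphism.Build A B to_ic to_ic_monoid.

Lemma ic_scaleE (a : A) (b : B) : a *: b = to_ic a * b.
Proof. exact: ic_frac_inj. Qed.

Lemma to_ic_inj : injective to_ic.
Proof.
by move=> a b /(congr1 ic_frac); rewrite !ic_frac_to => /eqP; rewrite tofrac_eq => /eqP.
Qed.

Lemma to_ic_eq0 a : (to_ic a == 0) = (a == 0).
Proof. by rewrite -(inj_eq to_ic_inj) rmorph0. Qed.

Lemma ic_denom (b : B) : exists a a' : A, a != 0 /\ to_ic a * b = to_ic a'.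
Proof.
have [a' [a [a0 e]]] := fracP (ic_frac b); exists a, a'; split=> //.
by apply: ic_frac_inj; rewrite rmorphM /= !ic_frac_to -e mulrC.
Qed.

Lemma ic_lift (x y : B) (z : K) : integralOver frac z ->
  ic_frac x * z = ic_frac y -> exists b : B, y = x * b.
Proof.
by move=> iz e; exists (ic_of iz); apply: ic_frac_inj; rewrite rmorphM /= -e.
Qed.

Lemma ic_monic (b : B) : exists P : {poly A},
  P \is monic /\ (map_poly to_ic P).[b] = 0.
Proof.
have [P mP rP] := ic_integral b; exists P; split=> //.
apply: ic_frac_inj; rewrite rmorph0 -horner_map /= -map_poly_comp.
exact/eqP.
Qed.

(** The determinant trick: multiplication by [y / x] maps the [A]-span of
    the [j i] into itself, so [y / x] is an eigenvalue of a matrix over [A]. *)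
Lemma ic_det_trick (x y : B) n (j : 'I_n -> B) (C : 'I_n -> 'I_n -> A) :
  x != 0 -> (exists i, j i != 0) ->
  (forall i, y * j i = x * \sum_l to_ic (C i l) * j l) ->
  exists b, y = x * b.
Proof.
move=> x0 [i0 ji0] e; have fx0 : ic_frac x != 0.
  by apply: contraNneq x0 => h; apply/eqP/ic_frac_inj; rewrite h rmorph0.
apply: (@ic_lift x y (ic_frac y / ic_frac x)) => //; last by rewrite mulrC divfK.
pose M : 'M[A]_n := \matrix_(u, v) C v u.
exists (char_poly M); first exact: char_poly_monic.
rewrite map_char_poly -eigenvalue_root_char.
apply/eigenvalueP; exists (\row_i ic_frac (j i)).
  apply/rowP => i; rewrite !mxE.
  rewrite -mulrAC; apply: (canRL (mulfK fx0)).
  rewrite -rmorphM e rmorphM mulrC; congr (_ * _); rewrite rmorph_sum; apply: eq_bigr => l _.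
  by rewrite !mxE rmorphM /= ic_frac_to mulrC.
apply/eqP => /rowP/(_ i0); rewrite !mxE => h; move/eqP: ji0; apply.
by apply: ic_frac_inj; rewrite h rmorph0.
Qed.

(** Multiplied by a power of [x], the monic equation of [b = x ^ -1] exhibits
    [1] as a multiple of [x] inside [A]. *)
Lemma ic_unit_lift (x : A) (b : B) : to_ic x * b = 1 -> exists a, x * a = 1.
Proof.
move=> xb; have [P [mP rP]] := ic_monic b.
have sP : (0 < size P)%N by rewrite size_poly_gt0 monic_neq0.
exists (- \sum_(i < (size P).-1) P`_i * x ^+ ((size P).-1 - i.+1)).
have e : \sum_(i < size P) P`_i * x ^+ ((size P).-1 - i) = 0.
  apply: to_ic_inj; rewrite rmorph0 rmorph_sum.
  transitivity (to_ic x ^+ (size P).-1 * (map_poly to_ic P).[b]); last by rewrite rP mulr0.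
  rewrite horner_coef size_map_poly_id0; last by rewrite (monicP mP) rmorph1 oner_neq0.
  rewrite mulr_sumr. apply: eq_bigr => i _; rewrite coef_map /= rmorphM rmorphXn /=.
  have ile : (i <= (size P).-1)%N by rewrite -ltnS prednK.
  by rewrite -{2}(subnK ile) exprD mulrCA -mulrA -exprMn xb expr1n mulr1.
have : \sum_(i < (size P).-1.+1) P`_i * x ^+ ((size P).-1 - i) = 0 by rewrite prednK.
rewrite big_ord_recr /= subnn expr0 mulr1.
have -> : P`_(size P).-1 = 1 by exact: (monicP mP).
move/eqP; rewrite addr_eq0 => /eqP h.
rewrite mulrN mulr_sumr -[1]opprK -h; congr (- _); apply: eq_bigr => i _.
by rewrite mulrCA -exprS subnSK.
Qed.

End IntegralClosureRing.
Arguments ic_frac {A} : simpl never.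
Arguments to_ic {A} : simpl never.


(** * Ideals of Noetherian rings and completeness *)

(** Unlike [idealr_closed], this admits the improper ideal. *)
Definition ideal (R : comNzRingType) (I : R -> Prop) : Prop :=
  I 0 /\ forall a x y, I x -> I y -> I (a * x + y).

(** Inclusion of the power [m ^ N] in [I], tested on products of [N] elements. *)
Definition pow_in (R : comNzRingType) (m : {pred R}) (N : nat) (I : R -> Prop) :=
  forall s : seq R, size s = N -> {subset s <= m} -> I (\prod_(x <- s) x).

(** Every power series in [x] has a sum, which need not be unique. *)
Definition x_complete (R : comNzRingType) (x : R) : Prop :=
  forall u : nat -> R, exists y, forall n, exists z,
    y = \sum_(i < n) x ^+ i * u i + x ^+ n * z.

Definition x_separated (R : comNzRingType) (N : lmodType R) (x : R) : Prop :=
  forall y : N, (forall n, exists z, y = x ^+ n *: z) -> y = 0.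

Section Ideals.
Variable R : comNzRingType.
Implicit Types (I J : R -> Prop) (m : {pred R}).

Lemma idealD I x y : ideal I -> I x -> I y -> I (x + y).
Proof. by move=> [_ h] Ix Iy; rewrite -[x]mul1r; apply: h. Qed.
Lemma idealM I a x : ideal I -> I x -> I (a * x).
Proof. by move=> [I0 h] Ix; rewrite -[a * x]addr0; apply: h. Qed.
Lemma idealMr I a x : ideal I -> I x -> I (x * a).
Proof. by rewrite mulrC; apply: idealM. Qed.
Lemma idealB I x y : ideal I -> I x -> I y -> I (x - y).
Proof. by move=> iI Ix Iy; rewrite -mulN1r addrC; apply: iI.2. Qed.
Lemma ideal_sum I (T : Type) (s : seq T) (F : T -> R) (P : pred T) :
  ideal I -> (forall i, P i -> I (F i)) -> I (\sum_(i <- s | P i) F i).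
Proof.
move=> iI h; elim/big_rec: _ => [|i x Pi Ix]; first exact: iI.1.
by apply: idealD => //; apply: h.
Qed.
Lemma ideal_full I : ideal I -> I 1 -> forall x, I x.
Proof. by move=> iI I1 x; rewrite -[x]mulr1; apply: idealM. Qed.

Lemma principal_ideal a : ideal (fun x : R => exists y, x = a * y).
Proof.
split; first by exists 0; rewrite mulr0.
by move=> c x y [u ->] [v ->]; exists (c * u + v); rewrite mulrDr mulrCA.
Qed.

Lemma ideal_adjoin I a : ideal I -> ideal (fun x : R => exists u y, I u /\ x = u + a * y).
Proof.
move=> iI; split; first by exists 0, 0; split; [exact: iI.1 | rewrite mulr0 addr0].
move=> c x y [u [u' [Iu ->]]] [v [v' [Iv ->]]].
exists (c * u + v), (c * u' + v'); split; first exact: iI.2.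
ring.
Qed.

Lemma ideal_colon I a : ideal I -> ideal (fun x => I (a * x)).
Proof.
move=> iI; split; first by rewrite mulr0; exact: iI.1.
by move=> c x y Ix Iy; rewrite mulrDr mulrCA; apply: iI.2.
Qed.

Lemma noeth_fg I : noetherian R -> ideal I ->
  exists n (g : 'I_n -> R), (forall i, I (g i)) /\
    forall x, I x -> exists c : 'I_n -> R, x = \sum_i c i * g i.
Proof.
move=> noe iI.
have [|n [g gP]] := noe (fun x : R^o => `[< I x >]).
  split; first by apply/asboolP; exact: iI.1.
  by move=> a x y /asboolP Ix /asboolP Iy; apply/asboolP; apply: iI.2.
exists n, g; split=> [i|x Ix].
  suff /asboolP : (g i : R^o) \in (fun x : R^o => `[< I x >]) by [].
  apply/gP; exists (fun l => (l == i)%:R).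
  rewrite (bigD1 i) //= eqxx scale1r big1 ?addr0 // => l /negPf ->.
  by rewrite scale0r.
by have [c ->] := (gP x).1 (introT (asboolP _) Ix); exists c.
Qed.

(** Noetherian induction on ideals: a failing ideal could be enlarged forever,
    while the union of the resulting chain is finitely generated. *)
Lemma noeth_ind (P : (R -> Prop) -> Prop) : noetherian R ->
  (forall I, ideal I ->
     (forall J, ideal J -> (forall x, I x -> J x) -> (exists2 x, J x & ~ I x) -> P J) ->
     P I) ->
  forall I, ideal I -> P I.
Proof.
move=> noe step I0 iI0; apply: contrapT => nP0.
pose X := {I : R -> Prop | ideal I /\ ~ P I}.
have next (U : X) : {V : X | (forall x, sval U x -> sval V x) /\
                             exists2 x, sval V x & ~ sval U x}.
  apply: cid; case: U => I [iI nP] /=.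
  apply: contrapT => h; apply: nP; apply: step => // J iJ sIJ pIJ.
  by apply: contrapT => nPJ; apply: h; exists (exist _ J (conj iJ nPJ)).
pose F := fix F n : X :=
  if n is n'.+1 then sval (next (F n')) else exist _ I0 (conj iI0 nP0).
have Fm n k x : sval (F n) x -> sval (F (n + k)%N) x.
  elim: k => [|k IHk] h; first by rewrite addn0.
  by rewrite addnS; apply: (svalP (next (F (n + k)%N))).1; apply: IHk.
have iF n : ideal (sval (F n)) by exact: (svalP (F n)).1.
pose U x := exists n, sval (F n) x.
have iU : ideal U.
  split; first by exists 0%N; exact: (iF 0%N).1.
  move=> a x y [n hx] [l hy]; exists (n + l)%N; apply: (iF _).2; first exact: Fm.
  by rewrite addnC; apply: Fm.
have [s [g [gU gen]]] := noeth_fg noe iU.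
have [f hf] := choice gU.
have hN i : sval (F (\max_i f i)) (g i).
  by rewrite -(subnKC (leq_bigmax i)); apply: Fm.
have [_ [x xN1]] := svalP (next (F (\max_i f i))); apply.
have [c ->] := gen x (ex_intro _ (\max_i f i).+1 xN1).
by apply: ideal_sum => // i _; apply: idealM.
Qed.

Lemma pow_in_ideal_pow m N I : ideal I -> pow_in m N I ->
  forall x, x \in ideal_pow m N -> I x.
Proof.
move=> iI h x /asboolP [n [c [f [fm ->]]]]; apply: ideal_sum => // j _; apply: idealM => //.
rewrite -(big_map (f j) xpredT id) /=; apply: h.
  by rewrite size_map -[index_enum _]enumT size_enum_ord.
by move=> y /mapP [i _ ->].
Qed.

Lemma pow_in_full m N I : ideal I -> I 1 -> pow_in m N I.
Proof. by move=> iI I1 s _ _; apply: ideal_full. Qed.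

Lemma pow_in_cons m N I a : a \in m -> pow_in m N.+1 I -> pow_in m N (fun x => I (a * x)).
Proof.
move=> am h s ss sm; rewrite -(big_cons _ _ _ _ xpredT id) /=; apply: h; rewrite /= ?ss //.
by move=> y; rewrite inE => /orP[/eqP -> //|]; apply: sm.
Qed.

(** An ideal maximal among those that contain [a] but no power of [m] is
    prime, so it suffices that every prime containing [a] contains [m]. *)
Lemma pow_in_of_primes m (a : R) : noetherian R ->
  (forall P, ideal P -> ~ P 1 -> (forall y z, P (y * z) -> P y \/ P z) -> P a ->
     forall x, x \in m -> P x) ->
  exists N, pow_in m N (fun x : R => exists y, x = a * y).
Proof.
move=> noe prm.
pose Q I := I a -> exists N, pow_in m N I.
suff /(_ _ (principal_ideal a)) : forall I, ideal I -> Q I.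
  by apply; exists 1; rewrite mulr1.
apply: noeth_ind => // I iI IH Ia.
have [I1|nI1] := pselect (I 1); first by exists 0%N; apply: pow_in_full.
have [pI|hm] := pselect (forall y z, I (y * z) -> I y \/ I z); last first.
  have : exists y z, [/\ I (y * z), ~ I y & ~ I z].
    apply: contrapT => h; apply: hm => y z Iyz; apply: contrapT => h'; apply: h.
    by exists y, z; split=> // h2; apply: h'; [left|right].
  move=> [y [z [Iyz nIy nIz]]].
  have big w : ~ I w -> exists N, pow_in m N (fun x : R => exists u v, I u /\ x = u + w * v).
    move=> nIw; apply: (IH _ (ideal_adjoin w iI)).
    - by move=> x Ix; exists x, 0; rewrite mulr0 addr0.
    - by exists w => //; exists 0, 1; rewrite mulr1 add0r; split=> //; exact: iI.1.
    - by exists a, 0; rewrite mulr0 addr0.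
  have [N1 h1] := big y nIy; have [N2 h2] := big z nIz.
  exists (N1 + N2)%N => s ss sm.
  rewrite -(cat_take_drop N1 s) big_cat /=.
  have [||u1 [v1 [Iu1 ->]]] := h1 (take N1 s).
  - by rewrite size_takel // ss leq_addr.
  - by move=> x /mem_take; apply: sm.
  have [||u2 [v2 [Iu2 ->]]] := h2 (drop N1 s).
  - by rewrite size_drop ss addKn.
  - by move=> x /mem_drop; apply: sm.
  have -> : (u1 + y * v1) * (u2 + z * v2) =
     (u2 + z * v2) * u1 + ((y * v1) * u2 + (v1 * v2) * (y * z)) by ring.
  by apply: iI.2 => //; apply: iI.2 => //; apply: idealM.
exists 1%N => -[|x []] // _ sm; rewrite big_seq1.
by apply: (prm I) => //; apply: sm; rewrite inE.
Qed.

(** Take a product of elements of [m], of maximal length, outside [J]. *)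
Lemma socle_elt m N J : pow_in m N J -> ~ J 1 ->
  exists2 y, ~ J y & forall x, x \in m -> J (x * y).
Proof.
elim: N => [|N IHN] h nJ1.
  by case: nJ1; have := h [::] erefl; rewrite big_nil; apply.
have [/IHN|nh] := pselect (pow_in m N J); first by apply.
have : exists s : seq R, [/\ size s = N, {subset s <= m} & ~ J (\prod_(x <- s) x)].
  by apply: contrapT => h'; apply: nh => s ss sm; apply: contrapT => h2; apply: h'; exists s.
move=> [s [ss sm nJs]]; exists (\prod_(x <- s) x) => // x xm.
by apply: (pow_in_cons xm h).
Qed.

(** Artinian-ness of [R / J] when [J] contains a power of the maximal ideal,
    by Noetherian induction: compare a chain above [J] with the chain obtained
    by adding a socle element [y] of [R / J]. *)
Lemma dcc m : noetherian R ->
  (forall a, a \notin m -> exists b, 1 - a * b \in m) ->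
  forall J, ideal J -> (exists N, pow_in m N J) ->
  forall I : nat -> R -> Prop, (forall n, ideal (I n)) ->
    (forall n x, I n.+1 x -> I n x) -> (forall n x, J x -> I n x) ->
  exists n0, forall n, (n0 <= n)%N -> forall x, I n0 x -> I n x.
Proof.
move=> noe minv; apply: noeth_ind => // J iJ IH [N hN] I iI dI JI.
have dec n k x : (n <= k)%N -> I k x -> I n x.
  move/subnKC <-; elim: (k - n)%N => [|l IHl]; first by rewrite addn0.
  by rewrite addnS => /dI /IHl.
have [J1|nJ1] := pselect (J 1).
  by exists 0%N => n _ x _; apply: JI; apply: ideal_full.
have [y nJy my] := socle_elt hN nJ1.
pose K n x := exists u v, I n u /\ x = u + y * v.
have IK n x : I n x -> K n x by move=> Ix; exists x, 0; rewrite mulr0 addr0.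
have [|||||||n1 st] := IH (fun x => exists u v, J u /\ x = u + y * v) _ _ _ _ K.
- exact: ideal_adjoin.
- by move=> x Jx; exists x, 0; rewrite mulr0 addr0.
- by exists y => //; exists 0, 1; rewrite mulr1 add0r; split=> //; exact: iJ.1.
- exists N => s ss sm; exists (\prod_(x <- s) x), 0.
  by rewrite mulr0 addr0; split=> //; apply: hN.
- by move=> n; apply: ideal_adjoin.
- by move=> n x [u [v [/dI Iu ->]]]; exists u, v.
- by move=> n x [u [v [Ju ->]]]; exists u, v; split=> //; apply: JI.
have [Iy|] := pselect (forall n, I n y).
  exists n1 => n /st h x /IK /h [u [v [Iu ->]]].
  by apply: idealD => //; apply: idealMr.
move/existsNP => [n2 nIy]; exists (maxn n1 n2) => n; rewrite geq_max => /andP[n1n n2n] x Ix.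
have [u [v [Iu ex]]] : K n x by apply: st n1n _ _; apply: IK; apply: dec Ix; apply: leq_maxl.
rewrite ex; apply: idealD => //.
have [vm|/minv [b bm]] := boolP (v \in m).
  by apply: JI; rewrite mulrC; apply: my.
case: nIy; have -> : y = (1 - v * b) * y + b * (y * v) by ring.
apply: idealD => //; first by apply: JI; apply: my.
apply: idealM => //; have -> : y * v = x - u by rewrite ex addrC addKr.
apply: idealB => //; first by apply: dec Ix; apply: leq_maxr.
exact: dec Iu.
Qed.

(** Expanding the coefficients of the generators again and again shows that the
    monomials of degree less than [N] in the generators span [R / m ^ N] over
    representatives [Q] of [R / m]. *)
Lemma span_mod_pow m n (g : 'I_n -> R) (Q : R -> Prop) :
  (forall i, g i \in m) ->
  (forall x, x \in m -> exists c : 'I_n -> R, x = \sum_i c i * g i) ->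
  (forall x, exists2 a, Q a & x - a \in m) ->
  forall N, exists (T : finType) (v : T -> R), forall x, exists a : T -> R,
    (forall i, Q (a i)) /\
    forall J, ideal J -> pow_in m N J -> J (x - \sum_i a i * v i).
Proof.
move=> gm gen rep; elim=> [|N [T [v IH]]].
  exists 'I_0, (fun=> 0) => x; exists (fun=> 0); split; first by case.
  move=> J iJ h; apply: ideal_full => //.
  by have := h [::] erefl; rewrite big_nil; apply.
exists ('I_1 + 'I_n * T)%type.
exists (fun o => if o is inr (i, t) then g i * v t else 1) => x.
have [a0 Qa0 /gen [c ec]] := rep x.
have [a ha] := choice (fun i => IH (c i)).
exists (fun o => if o is inr (i, t) then a i t else a0).
split; first by case=> [_|[i t]] //; apply: (ha i).1.
move=> J iJ h; rewrite big_sumType big_ord1 /= mulr1.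
rewrite (_ : \sum_(p : 'I_n * T) _ = \sum_i \sum_t a i t * (g i * v t)); last first.
  by rewrite pair_bigA; apply: eq_bigr => -[].
rewrite opprD addrA ec -sumrB; apply: ideal_sum => // i _.
have -> : c i * g i - \sum_t a i t * (g i * v t) = g i * (c i - \sum_t a i t * v t).
  rewrite mulrBr mulr_sumr mulrC; congr (_ - _); apply: eq_bigr => t _; ring.
by apply: ((ha i).2 (fun y => J (g i * y))); [apply: ideal_colon|apply: pow_in_cons].
Qed.

(** Nakayama's lemma over a complete ring: successive approximation gives
    convergent series for the coefficients. *)
Lemma complete_nakayama (x : R) (N : lmodType R) (T : finType) (g : T -> N) :
  x_complete x -> x_separated N x ->
  (forall y, exists (c : T -> R) (y' : N), y = \sum_i c i *: g i + x *: y') ->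
  forall y, exists c : T -> R, y = \sum_i c i *: g i.
Proof.
move=> cx sx step y.
have [c hc] := choice step; have [nx hnx] := choice hc.
pose Y n := iter n nx y.
have eY n : y = \sum_i (\sum_(j < n) x ^+ j * c (Y j) i) *: g i + x ^+ n *: Y n.
  elim: n => [|n IHn].
    by rewrite big1 ?add0r ?scale1r // => i _; rewrite big_ord0 scale0r.
  rewrite {1}IHn (hnx (Y n)) scalerDr scalerA -exprSr addrA; congr (_ + _).
  rewrite scaler_sumr -big_split; apply: eq_bigr => i _ /=.
  by rewrite big_ord_recr /= scalerDl scalerA.
have [C hC] := choice (fun i => cx (fun j => c (Y j) i)).
exists C; apply/eqP; rewrite -subr_eq0; apply/eqP; apply: sx => n.
have [z hz] := choice (fun i => hC i n).
exists (Y n - \sum_i z i *: g i).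
rewrite {1}(eY n) scalerBr addrAC [RHS]addrC; congr (_ + _).
rewrite scaler_sumr -sumrB -sumrN; apply: eq_bigr => i _.
by rewrite {1}(hz i) scalerDl opprD addNKr scalerA.
Qed.

Lemma x_complete_fg (x : R) (N : lmodType R) (T : finType) (g : T -> N) :
  x_complete x -> (forall y, exists c : T -> R, y = \sum_i c i *: g i) ->
  forall u : nat -> N, exists y, forall n, exists z,
    y = \sum_(i < n) x ^+ i *: u i + x ^+ n *: z.
Proof.
move=> cx gen u; have [c hc] := choice (fun j => gen (u j)).
have [C hC] := choice (fun i => cx (fun j => c j i)).
exists (\sum_i C i *: g i) => n.
have [z hz] := choice (fun i => hC i n).
exists (\sum_i z i *: g i).
under [X in _ = X + _]eq_bigr => j _ do rewrite hc scaler_sumr.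
rewrite exchange_big scaler_sumr -big_split; apply: eq_bigr => i _ /=.
rewrite {1}(hz i) scalerDl scalerA; congr (_ + _).
by rewrite scaler_suml; apply: eq_bigr => j _; rewrite scalerA.
Qed.

End Ideals.

(** * Modules over a domain up to torsion *)

Section TorsionModules.
Variables (R : idomainType) (N : lmodType R).

Definition torsion (y : N) : Prop := exists2 a : R, a != 0 & a *: y = 0.

Definition independent (I : finType) (u : I -> N) : Prop :=
  forall c : I -> R, \sum_i c i *: u i = 0 -> forall i, c i = 0.

(** The span of [u] over the fraction field, pulled back to [N]. *)
Definition tspan (I : finType) (u : I -> N) (y : N) : Prop :=
  exists2 a : R, a != 0 & exists c : I -> R, a *: y = \sum_i c i *: u i.

Lemma torsion0 : torsion 0.
Proof. by exists 1; rewrite ?oner_neq0 ?scaler0. Qed.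
Lemma torsionD y z : torsion y -> torsion z -> torsion (y + z).
Proof.
move=> [a a0 ay] [b b0 bz]; exists (a * b); first by rewrite mulf_neq0.
by rewrite scalerDr -[_ *: z]scalerA bz mulrC -scalerA ay !scaler0 addr0.
Qed.
Lemma torsionZ c y : torsion y -> torsion (c *: y).
Proof. by move=> [a a0 ay]; exists a => //; rewrite scalerA mulrC -scalerA ay scaler0. Qed.
Lemma torsionN y : torsion y -> torsion (- y).
Proof. by rewrite -scaleN1r; apply: torsionZ. Qed.
Lemma torsion_sum (I : Type) (s : seq I) (F : I -> N) (P : pred I) :
  (forall i, P i -> torsion (F i)) -> torsion (\sum_(i <- s | P i) F i).
Proof. by move=> h; elim/big_ind: _ => //; [apply: torsion0 | apply: torsionD]. Qed.
Lemma torsion_cancel c y : c != 0 -> torsion (c *: y) -> torsion y.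
Proof.
by move=> c0 [a a0 h]; exists (a * c); rewrite ?mulf_neq0 // -scalerA.
Qed.

Lemma tspanD (I : finType) (u : I -> N) y z : tspan u y -> tspan u z -> tspan u (y + z).
Proof.
move=> [a a0 [c ey]] [b b0 [d ez]]; exists (a * b); first by rewrite mulf_neq0.
exists (fun i => b * c i + a * d i).
rewrite scalerDr -[_ *: z]scalerA ez mulrC -scalerA ey !scaler_sumr -big_split.
by apply: eq_bigr => i _; rewrite scalerDl !scalerA.
Qed.
Lemma tspanZ (I : finType) (u : I -> N) k y : tspan u y -> tspan u (k *: y).
Proof.
move=> [a a0 [c ey]]; exists a => //; exists (fun i => k * c i).
rewrite scalerA mulrC -scalerA ey scaler_sumr.
by apply: eq_bigr => i _; rewrite scalerA.
Qed.
Lemma tspan0 (I : finType) (u : I -> N) : tspan u 0.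
Proof.
exists 1; rewrite ?oner_neq0 //; exists (fun=> 0); rewrite scaler0 big1 // => i _.
exact: scale0r.
Qed.
Lemma tspan_sum (I T : finType) (u : I -> N) (F : T -> N) :
  (forall i, tspan u (F i)) -> tspan u (\sum_i F i).
Proof. by move=> h; elim/big_ind: _ => //; [apply: tspan0 | apply: tspanD]. Qed.

Lemma tspan_coefs (X : Type) (I : finType) (u : I -> N) (F : X -> N) :
  (forall x, tspan u (F x)) -> exists (a : X -> R) (c : X -> I -> R),
    (forall x, a x != 0) /\ forall x, a x *: F x = \sum_i c x i *: u i.
Proof.
move=> h; have /choice [a ha] : forall x, exists a, a != 0 /\ exists c, a *: F x = \sum_i c i *: u i.
  by move=> x; have [a a0 e] := h x; exists a.
have [c hc] := choice (fun x => (ha x).2).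
by exists a, c; split=> // x; apply: (ha x).1.
Qed.

Lemma common_denominator n (f : 'I_n -> {fraction R}) :
  exists2 b : R, b != 0 & exists a : 'I_n -> R,
    forall i, f i * FracField.tofrac b = FracField.tofrac (a i).
Proof.
have [a ha] := choice (fun i => fracP (f i)); have [b hb] := choice ha.
exists (\prod_i b i); first by apply/prodf_neq0 => i _; apply: (hb i).1.
exists (fun i => a i * \prod_(j | j != i) b j) => i.
by rewrite (bigD1 i) //= rmorphM mulrA (hb i).2 rmorphM.
Qed.

Lemma left_kernel n k (M : 'M[R]_(n, k)) : (k < n)%N ->
  exists d : 'I_n -> R, (exists i, d i != 0) /\ forall j, \sum_i d i * M i j = 0.
Proof.
move=> kn; pose F := map_mx (@FracField.tofrac R) M.
have : kermx F != 0.
  rewrite -mxrank_eq0 mxrank_ker subn_eq0 -ltnNge.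
  exact: leq_ltn_trans (rank_leq_col F) kn.
case/rowV0Pn => v /sub_kermxP vF v0.
have [b b0 [a ha]] := common_denominator (fun i => v 0 i).
exists a; split.
  apply: contrapT => h; case/negP: v0; apply/eqP/rowP => i; rewrite mxE.
  have [ai0|ai0] := eqVneq (a i) 0; last by case: h; exists i.
  apply/eqP; have /eqP := ha i; rewrite ai0 rmorph0 mulf_eq0 tofrac_eq0 (negPf b0).
  by rewrite orbF.
move=> j; apply/eqP; rewrite -tofrac_eq0 rmorph_sum /=.
have /rowP/(_ j) := vF; rewrite !mxE => h.
have {}h := congr1 ( *%R^~ (FracField.tofrac b)) h; rewrite /= mul0r mulr_suml in h.
apply/eqP; rewrite -[RHS]h.
by apply: eq_bigr => i _; rewrite !mxE rmorphM /= -ha mulrAC.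
Qed.

(** Otherwise the matrix expressing multiples of the [u i] through the [w j]
    has a nonzero left kernel, over the fraction field and hence over [R], and
    a kernel vector is a relation among the [u i]. *)
Lemma independent_card (I J : finType) (u : I -> N) (w : J -> N) :
  independent u -> (forall i, tspan w (u i)) -> (#|I| <= #|J|)%N.
Proof.
move=> iu sp; rewrite leqNgt; apply/negP => lt.
have [a [c [a0 hc]]] := tspan_coefs sp.
pose M : 'M_(#|I|, #|J|) := \matrix_(i, j) c (enum_val i) (enum_val j).
have [d [[i0 di0] dM]] := left_kernel M lt.
have e : \sum_i (d (enum_rank i) * a i) *: u i = 0.
  under eq_bigr => i _ do rewrite -scalerA hc scaler_sumr.
  rewrite exchange_big big1 //= => j _.
  under eq_bigr => i _ do rewrite scalerA.
  rewrite -scaler_suml; have := dM (enum_rank j).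
  under eq_bigr => i _ do rewrite mxE enum_rankK.
  rewrite (reindex _ (onW_bij _ (@enum_rank_bij I))) /=.
  under eq_bigr => i _ do rewrite enum_rankK.
  by move=> ->; rewrite scale0r.
have /eqP := iu _ e (enum_val i0); rewrite enum_valK mulf_eq0 (negPf di0) /=.
exact/negP.
Qed.

(** Take a subfamily of [g] that is maximal among the independent ones: adding
    another [g i] creates a relation in which [g i] has a nonzero coefficient. *)
Lemma max_independent (T : finType) (g : T -> N) :
  exists n (u : 'I_n -> N), independent u /\ forall i, tspan u (g i).
Proof.
pose P (S : {set T}) := `[< forall c : T -> R, \sum_(i in S) c i *: g i = 0 ->
                              forall i, i \in S -> c i = 0 >].
have [|S /maxsetP [/asboolP iS maxS]] := @ex_maxset _ P.
  by exists set0; apply/asboolP => c _ i; rewrite inE.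
exists #|S|, (fun i => g (enum_val i)); split.
  move=> c h i; have := iS (fun x => if x \in S =P true is ReflectT xS
      then c (enum_rank_in xS x) else 0).
  rewrite big_enum_val => /(_ _ (enum_val i) (enum_valP i)).
  case: eqP => [xS|]; last by rewrite enum_valP.
  rewrite enum_valK_in; apply; rewrite -[RHS]h; apply: eq_bigr => j _.
  by case: eqP => [yS|]; rewrite ?enum_valK_in ?enum_valP.
move=> x; have [xS|xS] := boolP (x \in S).
  exists 1; rewrite ?oner_neq0 //; exists (fun j => (j == enum_rank_in xS x)%:R).
  rewrite (bigD1 (enum_rank_in xS x)) //= eqxx !scale1r enum_rankK_in //.
  by rewrite big1 ?addr0 // => j /negPf ->; rewrite scale0r.
have : ~ P (x |: S).
  by move=> h; have := maxS _ h (subsetUr _ _); move: xS => /[swap] <-; rewrite setU11.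
move=> nP; have /existsNP : ~ (forall c : T -> R, \sum_(i in x |: S) c i *: g i = 0 ->
    forall i, i \in x |: S -> c i = 0) by move=> h; apply: nP; apply/asboolP.
move=> [c /not_implyP [ec /existsNP [y /not_implyP [yS cy]]]].
move: ec; rewrite big_setU1 //= => ec.
have cx : c x != 0.
  apply/eqP => cx0; rewrite cx0 scale0r add0r in ec; apply: cy.
  by move: yS; rewrite !inE => /orP[/eqP -> //|]; apply: iS.
exists (c x) => //; exists (fun i => - c (enum_val i)).
move/eqP: ec; rewrite addr_eq0 => /eqP ->; rewrite big_enum_val -sumrN.
by apply: eq_bigr => i _; rewrite scaleNr.
Qed.

Definition euclidean : Prop := exists d : R -> nat, forall a b, b != 0 ->
  exists q r, a = q * b + r /\ (r = 0 \/ (d r < d b)%N).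

(** Euclid's algorithm on the coefficients of a relation among generators
    shortens the list of generators until no relation is left. *)
Lemma free_mod_torsion n (w : 'I_n -> N) : euclidean ->
  (forall y, exists c : 'I_n -> R, torsion (y - \sum_i c i *: w i)) ->
  exists n' (w' : 'I_n' -> N),
    (forall y, exists c : 'I_n' -> R, torsion (y - \sum_i c i *: w' i)) /\
    (forall c, torsion (\sum_i c i *: w' i) -> forall i, c i = 0).
Proof.
move=> [d hd]; elim: n w => [|n IHn] w gen; first by exists 0%N, w; split=> // c _ [].
have [|] := pselect (forall c, torsion (\sum_i c i *: w i) -> forall i, c i = 0).
  by exists n.+1, w.
move/existsNP => [c /not_implyP [tc /existsNP [i /eqP ci0]]].
have [D leD] := ubnP (d (c i)).
elim: D => // D IHD in w gen c i tc ci0 leD *.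
have [q hq] := choice (fun j => hd (c j) (c i) ci0); have [r hr] := choice hq.
(* Dividing the other coefficients by [c i] and absorbing the quotients into
   [w i] leaves a relation with coefficients [c i] and the remainders. *)
pose wi := w i + \sum_(j | j != i) q j *: w j.
have ew : \sum_j c j *: w j = c i *: wi + \sum_(j | j != i) r j *: w j.
  rewrite (bigD1 i) //= scalerDr -addrA; congr (_ + _).
  rewrite scaler_sumr -big_split; apply: eq_bigr => j _ /=.
  by rewrite {1}(hr j).1 scalerDl scalerA [c i * _]mulrC.
pose w' j := if j == i then wi else w j.
have gen' y : exists c : 'I_n.+1 -> R, torsion (y - \sum_i c i *: w' i).
  have [e he] := gen y; exists (fun j => if j == i then e i else e j - e i * q j).
  rewrite (_ : \sum_j _ = \sum_j e j *: w j) //.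
  rewrite (bigD1 i) //= [RHS](bigD1 i) //= /w' eqxx /wi scalerDr -addrA; congr (_ + _).
  rewrite scaler_sumr -big_split; apply: eq_bigr => j /negPf -> /=.
  by rewrite scalerBl scalerA addrC subrK.
have [[j ji rj]|nr] := pselect (exists2 j, j != i & r j != 0).
  apply: (IHD w' gen' (fun j => if j == i then c i else r j) j).
  - rewrite (bigD1 i) //= /w' eqxx; rewrite ew in tc.
    by under eq_bigr => l /negPf -> do [].
  - by rewrite (negPf ji).
  - rewrite (negPf ji); case: (hr j).2 => [rj0|lt]; first by rewrite rj0 eqxx in rj.
    exact: leq_trans lt _.
(* All remainders vanish, so [wi] is torsion and can be dropped. *)
have twi : torsion wi.
  apply: (torsion_cancel ci0); move: tc; rewrite ew [X in _ + X]big1 ?addr0 // => j ji.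
  have [->|rj] := eqVneq (r j) 0; first by rewrite scale0r.
  by case: nr; exists j.
apply: (IHn (fun j => w (lift i j))) => y.
have [e he] := gen' y; exists (fun j => e (lift i j)).
rewrite (bigD1_ord i) //= opprD addrA addrAC in he.
have -> : y - \sum_j e (lift i j) *: w (lift i j) =
   (y - \sum_(j < n) e (lift i j) *: w' (lift i j) - e i *: w' i) + e i *: w' i.
  rewrite subrK; congr (_ - _); apply: eq_bigr => j _.
  by rewrite /w' eq_sym (negPf (neq_lift i j)).
by apply: torsionD => //; apply: torsionZ; rewrite /w' eqxx.
Qed.

End TorsionModules.

(** Coordinates with respect to a maximal independent family of [s] elements
    define a balanced map from [M] and the fraction field [K] to [K ^ s].  It
    shows that the family stays free in the tensor product, where it also
    spans; hence [s] is the rank. *)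
Lemma rank_basis (A : idomainType) (M : lmodType A) (r : nat) :
  fin_gen M -> has_rank M r ->
  exists u : 'I_r -> M, independent u /\ forall y, tspan u y.
Proof.
move=> [n [g gen]] [V [t [[[tDl tDr tZ] univ] tK dimV]]].
have [s [u [iu su]]] := max_independent g.
have {}su y : tspan u y.
  by have [c ->] := (gen y).1 isT; apply: tspan_sum => i; apply: tspanZ.
suff <- : s = r by exists u.
have [a' [c [a0 hc]]] := tspan_coefs su.
pose f (x : A) := FracField.tofrac x.
have f0 (x : A) : x != 0 -> f x != 0 by rewrite tofrac_eq0.
pose co y : 'rV[{fraction A}]_s := \row_j (f (c y j) / f (a' y)).
have co_uniq y b d : b != 0 -> b *: y = \sum_j d j *: u j ->
    co y = \row_j (f (d j) / f b).
  move=> b0 e; apply/rowP => j; rewrite !mxE.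
  apply/eqP; rewrite eqr_div ?f0 // -!rmorphM tofrac_eq.
  rewrite -subr_eq0; apply/eqP; move: j; apply: iu.
  under eq_bigr => j _ do rewrite scalerBl [c y j * _]mulrC [d j * _]mulrC -!scalerA.
  by rewrite sumrB -!scaler_sumr -hc -e !scalerA mulrC subrr.
have coD y z : co (y + z) = co y + co z.
  rewrite (@co_uniq _ (a' y * a' z) (fun j => a' z * c y j + a' y * c z j)).
  - apply/rowP => j; rewrite !mxE /f rmorphD !rmorphM /= addf_div ?tofrac_eq0 ?a0 //.
    by congr (_ / _); rewrite mulrC [X in _ + X]mulrC.
  - by rewrite mulf_neq0.
  rewrite scalerDr -[_ *: z]scalerA hc mulrC -scalerA hc !scaler_sumr -big_split.
  by apply: eq_bigr => i _; rewrite scalerDl !scalerA.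
have coZ b y : co (b *: y) = f b *: co y.
  rewrite (@co_uniq _ (a' y) (fun j => b * c y j)) //.
    by apply/rowP => j; rewrite !mxE /f rmorphM mulrA.
  rewrite scalerA mulrC -scalerA hc scaler_sumr.
  by apply: eq_bigr => i _; rewrite scalerA.
have cou i : co (u i) = delta_mx 0 i.
  rewrite (@co_uniq _ 1 (fun j => (j == i)%:R)) ?oner_neq0 //.
    apply/rowP => j; rewrite !mxE eqxx /= /f rmorph_nat rmorph1 divr1.
    by rewrite eq_sym.
  rewrite scale1r (bigD1 i) //= eqxx scale1r big1 ?addr0 // => j /negPf ->.
  by rewrite scale0r.
have [[gg hgg] _] := univ 'rV[{fraction A}]_s (fun y (z : frac_module A) =>
    (z : {fraction A}) *: co y) (And3
  (fun x x' (z : frac_module A) => etrans (congr1 _ (coD x x')) (scalerDr _ _ _))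
  (fun x (z z' : frac_module A) => scalerDl _ _ _)
  (fun b x (z : frac_module A) => etrans (congr1 _ (coZ b x))
     (etrans (scalerA _ _ _) (congr1 ( *:%R^~ _) (mulrC _ _))))).
pose one : frac_module A := (1 : {fraction A}).
pose X := [tuple t (u i) one | i < s].
have tE x (z : {fraction A}) : t x z = z *: t x one by rewrite -tK mulr1.
have t0 z : t 0 z = 0 by have /eqP := tDl 0 0 z; rewrite addr0 -subr_eq0 opprD addNKr oppr_eq0 => /eqP.
have t_sum (I : finType) (F : I -> M) z : t (\sum_i F i) z = \sum_i t (F i) z.
  by apply: (big_morph (fun y => t y z)).
have tA (b : A) x : t (b *: x) one = f b *: t x one by rewrite tZ -tK.
have freeX : free X.
  apply/freeP => k e i.
  have : gg (\sum_i t (u i) (k i)) = 0.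
    transitivity (gg (\sum_(j < s) k j *: X`_j)); last by rewrite e raddf0.
    congr (gg _); apply: eq_bigr => j _.
    by rewrite -tnth_nth tnth_mktuple tE.
  rewrite raddf_sum /= => /rowP/(_ i); rewrite summxE mxE => <-.
  rewrite (bigD1 i) //= hgg cou !mxE !eqxx mulr1 big1 ?addr0 // => j ji.
  by rewrite hgg cou !mxE eqxx /= eq_sym (negPf ji) mulr0.
have tX x z : t x z \in <<X>>%VS.
  rewrite tE memvZ // -[t x one]scale1r -(mulVf (f0 _ (a0 x))) -scalerA memvZ //.
  rewrite -tA hc t_sum memv_suml // => i _; rewrite tA memvZ //.
  by apply: memv_span; apply/tnthP; exists i; rewrite tnth_mktuple.
have full : fullv = <<X>>%VS.
  apply/eqP; rewrite eqEsubv subvf andbT; apply/subvP => v _.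
  have [_ /(_ idfun (projv <<X>>%VS)) h] := univ _ _ (And3 tDl tDr tZ).
  rewrite -[v]/(idfun v) h ?memv_proj // => x z /=.
  by rewrite projv_id.
by rewrite -dimV full; move/eqP: freeX; rewrite size_tuple.
Qed.

(** * Direct sums and composition series *)

Section ModuleIsomorphisms.
Variable R : pzRingType.

Lemma lmod_iso_sym (U V : lmodType R) : lmod_iso U V -> lmod_iso V U.
Proof.
move=> [f [g fK gK]].
have lg : linear g by move=> a u v; rewrite -{1}[u]gK -{1}[v]gK -linearP fK.
pose h : {linear V -> U} := HB.pack g (GRing.isLinear.Build R V U *:%R g lg).
by exists h, f.
Qed.

Lemma lmod_iso_trans (U V W : lmodType R) : lmod_iso U V -> lmod_iso V W -> lmod_iso U W.
Proof.
move=> [f bf] [g bg].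
have lh : linear (g \o f) by move=> a u v; rewrite /= !linearP.
pose h : {linear U -> W} := HB.pack (g \o f) (GRing.isLinear.Build R U W *:%R (g \o f) lh).
by exists h; apply: bij_comp.
Qed.

Lemma lmod_iso_intro (U V : lmodType R) (f : U -> V) : linear f -> injective f ->
  (forall v, exists u, f u = v) -> lmod_iso U V.
Proof.
move=> lf inj_f surj_f.
pose h : {linear U -> V} := HB.pack f (GRing.isLinear.Build R U V *:%R f lf).
have [g hg] := choice surj_f.
by exists h, g => // u; apply: inj_f; rewrite hg.
Qed.

Lemma lmod_iso_ffun1 (U : lmodType R) n : n = 1%N -> lmod_iso ({ffun 'I_n -> U} : lmodType R) U.
Proof.
move->; apply: (@lmod_iso_intro _ _ (fun f : {ffun 'I_1 -> U} => f ord0)).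
- by move=> a u v; rewrite !ffunE.
- by move=> u v e; apply/ffunP => i; rewrite ord1.
by move=> v; exists [ffun=> v]; rewrite ffunE.
Qed.

Lemma fin_genI (V : lmodType R) (T : finType) (g : T -> V) :
  (forall x, exists c : T -> R, x = \sum_i c i *: g i) -> fin_gen V.
Proof.
move=> gen; exists #|T|, (fun i => g (enum_val i)) => x; split=> // _.
have [c ->] := gen x; exists (fun i => c (enum_val i)).
by rewrite (reindex _ (onW_bij _ (@enum_val_bij T))).
Qed.

Lemma dirsum_two s (N : 'I_s -> lmodType R) (n : 'I_s -> nat) (i0 i1 : 'I_s) :
  i0 != i1 -> (forall i, i != i0 -> i != i1 -> n i = 0%N) ->
  lmod_iso (dirsum (fun i : 'I_s => ({ffun 'I_(n i) -> N i} : lmodType R)))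
    (({ffun 'I_(n i0) -> N i0} * {ffun 'I_(n i1) -> N i1})%type : lmodType R).
Proof.
move=> i01 n0; pose D := dirsum (fun i : 'I_s => ({ffun 'I_(n i) -> N i} : lmodType R)).
apply: (@lmod_iso_intro D _ (fun u : D => (u i0, u i1))).
- by [].
- move=> u v [e0 e1]; apply: functional_extensionality_dep => i.
  have [->//|h0] := eqVneq i i0; have [->//|h1] := eqVneq i i1.
  by apply/ffunP => j; exfalso; move: j; rewrite n0 // => -[].
move=> [x y]; pose z : D := 0.
exists (dfwith (dfwith z x) y : D).
by rewrite dfwith_out 1?eq_sym // !dfwith_in.
Qed.

Lemma dirsum_one s (N : 'I_s -> lmodType R) (n : 'I_s -> nat) (i0 : 'I_s) :
  (forall i, i != i0 -> n i = 0%N) ->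
  lmod_iso (dirsum (fun i : 'I_s => ({ffun 'I_(n i) -> N i} : lmodType R)))
    ({ffun 'I_(n i0) -> N i0} : lmodType R).
Proof.
move=> n0; pose D := dirsum (fun i : 'I_s => ({ffun 'I_(n i) -> N i} : lmodType R)).
apply: (@lmod_iso_intro D _ (fun u : D => u i0)).
- by [].
- move=> u v e0; apply: functional_extensionality_dep => i.
  have [->//|h0] := eqVneq i i0.
  by apply/ffunP => j; exfalso; move: j; rewrite n0 // => -[].
move=> x; pose z : D := 0.
by exists (dfwith z x : D); rewrite dfwith_in.
Qed.

End ModuleIsomorphisms.

Lemma ideal_powX (R : comNzRingType) (m : {pred R}) a n :
  a \in m -> a ^+ n \in ideal_pow m n.
Proof.
move=> am; apply/asboolP; exists 1%N, (fun=> 1), (fun _ _ => a); split=> //.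
by rewrite big_ord1 mul1r prodr_const card_ord.
Qed.

Section ResidueBasis.
Variables (A : comNzRingType) (m : {pred A}) (M : lmodType A) (l : nat).
Hypothesis mM : forall a b, a \in m -> b * a \in m.
Hypothesis minv : forall a, a \notin m -> exists b, 1 - a * b \in m.

(** The factors of a composition series of [H0 m M] are killed by [m].  Indeed,
    if [a z] were outside the previous submodule, it would generate the factor,
    so [z] would be congruent to [s z] with [s] in [m], hence to every
    [s ^ n z], and these vanish for large [n].  One element from each step
    therefore gives a basis over the residue field; the scalars [a ^ q]
    represent all residue classes because that field is perfect, and [m] acts
    as zero through [a |-> a ^ q] as soon as [q] is at least the length. *)
Lemma residue_basis (q : nat) : has_length (H0 m M) l -> (0 < q)%N -> (l <= q)%N ->
  (forall a, exists a', a - a' ^+ q \in m) ->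
  exists y : 'I_l -> M,
  [/\ forall a z, a \in m -> z \in H0 m M -> a ^+ q *: z = 0,
      forall j, y j \in H0 m M,
      forall z, z \in H0 m M -> exists a : 'I_l -> A, z = \sum_j a j ^+ q *: y j &
      forall a : 'I_l -> A, \sum_j a j ^+ q *: y j = 0 -> forall j, a j \in m].
Proof.
move=> [C [subC C0 CH simpleC]] q0 lq perf.
have mX n a : (0 < n)%N -> a \in m -> a ^+ n \in m.
  by case: n => // n _ am; rewrite exprSr; apply: mM.
have Z i : (i <= l)%N -> forall a z, z \in C i -> a *: z \in C i.
  move=> il a z zC; rewrite -[a *: z]addr0; apply: (subC i il).2 => //.
  exact: (subC i il).1.
have D i : (i <= l)%N -> forall y z, y \in C i -> z \in C i -> y + z \in C i.
  by move=> il y z yC zC; rewrite -[y]scale1r; apply: (subC i il).2.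
have Bc i : (i <= l)%N -> forall y z, y \in C i -> z \in C i -> y - z \in C i.
  by move=> il y z yC zC; apply: D => //; rewrite -scaleN1r; apply: Z.
have mono i j : (i <= j)%N -> (j <= l)%N -> {subset C i <= C j}.
  move=> /subnKC <-; elim: (j - i)%N => [|d IHd] h z zC; first by rewrite addn0.
  rewrite addnS in h *; apply: (simpleC (i + d)%N h).1.1.
  by apply: IHd => //; apply: ltnW.
have adj i y : (i < l)%N -> y \in C i.+1 -> y \notin C i ->
    forall z, z \in C i.+1 -> exists c b, c \in C i /\ z = c + b *: y.
  move=> il yS yC z zS.
  pose N : {pred M} := fun z => `[< exists c b, c \in C i /\ z = c + b *: y >].
  have ile := ltnW il.
  have sN : submod_closed N.
    split.
      by apply/asboolP; exists 0, 0; rewrite scale0r addr0; split=> //; apply: (subC i ile).1.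
    move=> a u v /asboolP[c [b [cC ->]]] /asboolP[c' [b' [cC' ->]]]; apply/asboolP.
    exists (a *: c + c'), (a * b + b'); split; first exact: (subC i ile).2.
    by rewrite scalerDr scalerDl scalerA addrACA.
  have [||e|e] := (simpleC i il).2 N sN.
  - by move=> u uC; apply/asboolP; exists u, 0; rewrite scale0r addr0.
  - move=> u /asboolP[c [b [cC ->]]]; apply: D => //; last exact: Z.
    exact: (simpleC i il).1.1.
  - case/negP: yC; rewrite -e; apply/asboolP; exists 0, 1; rewrite scale1r add0r.
    by split=> //; apply: (subC i ile).1.
  by have /asboolP : z \in N by rewrite e.
have mC i : (i < l)%N -> forall a z, a \in m -> z \in C i.+1 -> a *: z \in C i.
  move=> il a z am zC; apply: contrapT => /negP azC.
  have ile := ltnW il.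
  have [c [b [cC ez]]] := adj i _ il (Z _ il a z zC) azC z zC.
  pose s := b * a; have sm : s \in m by apply: mM.
  have zsz : z - s *: z \in C i by rewrite {1}ez scalerA addrK.
  have zsn n : z - s ^+ n *: z \in C i.
    elim: n => [|n IHn]; first by rewrite expr0 scale1r subrr; apply: (subC i ile).1.
    have -> : z - s ^+ n.+1 *: z = (z - s ^+ n *: z) + s ^+ n *: (z - s *: z).
      by rewrite scalerBr scalerA -exprSr addrA subrK.
    by apply: D => //; apply: Z.
  have : z \in H0 m M by rewrite -CH; apply: mono zC.
  move=> /asboolP [n hn]; have := zsn n; rewrite hn ?ideal_powX // subr0 => zi.
  by case/negP: azC; apply: Z.
have kill i : (i <= l)%N -> forall a z, a \in m -> z \in C i -> a ^+ i *: z = 0.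
  elim: i => [|i IHi] il a z am zC.
    by move: zC; rewrite C0 inE expr0 scale1r => /eqP.
  by rewrite exprSr -scalerA IHi //; [apply: ltnW | apply: mC].
have killH a z : a \in m -> z \in H0 m M -> a ^+ q *: z = 0.
  by move=> am; rewrite -CH -(subnK lq) exprD -scalerA => /kill->//; rewrite scaler0.
have /choice [y hy] : forall i, exists y, (i < l)%N -> y \in C i.+1 /\ y \notin C i.
  move=> i.
  have [il|] := boolP (i < l)%N; last by exists 0.
  apply: contrapT => h; apply: (simpleC i il).1.2 => z zC; apply: contrapT => /negP zn.
  by apply: h; exists z.
have gen i : (i <= l)%N -> forall z, z \in C i ->
    exists a : nat -> A, z = \sum_(j < i) a j ^+ q *: y j.
  elim: i => [|i IHi] il z zC.
    by exists (fun=> 0); rewrite big_ord0; apply/eqP; move: zC; rewrite C0.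
  have [yC ynC] := hy i il.
  have [c [b [cC ez]]] := adj i _ il yC ynC z zC; have [b' hb] := perf b.
  have [|a ha] := IHi (ltnW il) (c + (b - b' ^+ q) *: y i).
    by apply: D => //; [exact: ltnW | apply: mC].
  exists (fun j => if j == i then b' else a j); rewrite big_ord_recr /= eqxx.
  under eq_bigr => j _ do rewrite (ltn_eqF (ltn_ord j)).
  by rewrite -ha -addrA -scalerDl subrK.
have ind i : (i <= l)%N -> forall a : nat -> A,
    \sum_(j < i) a j ^+ q *: y j = 0 -> forall j, (j < i)%N -> a j \in m.
  elim: i => [|i IHi] il a // e.
  have [yC ynC] := hy i il; have ile := ltnW il.
  have yH : y i \in H0 m M by rewrite -CH; apply: mono yC.
  rewrite big_ord_recr /= in e.
  have ai : a i \in m.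
    apply: contrapT => /negP an.
    have aq : a i ^+ q *: y i \in C i.
      move/eqP: e; rewrite addrC addr_eq0 => /eqP ->; rewrite -scaleN1r; apply: (Z) => //.
      apply: (big_ind (fun z => z \in C i)) => [|u v uC vC|j _]; [exact: (subC i ile).1 | exact: D |].
      have jl : (j < l)%N by apply: ltn_trans il.
      by apply: Z => //; apply: (mono j.+1) => //; exact: (hy j jl).1.
    have [b bm] : exists b, 1 - a i ^+ q * b \in m.
      have [b bm] := minv an; exists (b ^+ q).
      rewrite -exprMn -[X in X - _](expr1n _ q) subrXX mulrC; exact: mM.
    case/negP: ynC; rewrite -[y i](subrK ((a i ^+ q * b) *: y i)).
    apply: D => //; last by rewrite mulrC -scalerA; apply: Z.
    by rewrite -{1}[y i]scale1r -scalerBl; apply: mC.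
  move=> j; rewrite ltnS leq_eqVlt => /orP[/eqP -> //|]; apply: IHi => //.
  by rewrite killH // addr0 in e.
exists (fun j => y j); split=> //.
- by move=> j; rewrite -CH; apply: (mono j.+1) => //; exact: (hy j (ltn_ord j)).1.
- by move=> z; rewrite -CH => /(gen _ (leqnn l)) [a ->]; exists (fun j => a j).
move=> a e j.
pose a' i := if insub i is Some o then a o else 0.
have ea i : a' (val i) = a i by rewrite /a' valK.
rewrite -ea; apply: (ind l (leqnn l)) (ltn_ord j); rewrite -[RHS]e.
by apply: eq_bigr => i _; rewrite ea.
Qed.

End ResidueBasis.

(** * Decomposition of Frobenius modules from a uniformizer *)

Lemma pchar_to_ic (A : idomainType) p : p \in [pchar A] -> p \in [pchar integral_closure A].
Proof. exact: (rmorph_pchar (@to_ic A)). Qed.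

Section Uniformizer.
Variables (A : idomainType) (p : nat) (pcharA : p \in [pchar A]).
Variables (m : {pred A}) (k : fieldType) (pi : {rmorphism A -> k}).
Local Notation B := (integral_closure A).
Local Notation pcharB := (pchar_to_ic pcharA).

(** What [B = k[[t]]] in the complete case and [B = k[t]] in the graded case
    have in common; [t ^ c] lies in the conductor of [B] over [A]. *)
Record uniformizer (t : B) (c : nat) : Prop := Uniformizer {
  uni_neq0 : t != 0;
  uni_nonunit : forall b, t * b != 1;
  uni_conductor : forall b, exists a, to_ic a = t ^+ c * b;
  uni_residue : forall b, exists a b', b = to_ic a + t * b';
  uni_max : forall a, a \in m -> exists b, to_ic a = t * b;
  uni_euclidean : euclidean B;
  uni_separated : forall b, (forall n, exists z, b = t ^+ n * z) -> b = 0;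
  uni_frobenius : forall e b, exists d : 'I_(p ^ e) -> B,
    b = \sum_j d j ^+ (p ^ e) * t ^+ j }.

Hypotheses (noeA : noetherian A) (resk : residue_field m pi).
Hypothesis closedk : GRing.closed_field_axiom k.

Lemma p_gt0 : (0 < p)%N.
Proof. by apply: prime_gt0; case/andP: pcharA. Qed.
Lemma q_gt0 e : (0 < p ^ e)%N.
Proof. by rewrite expn_gt0 p_gt0. Qed.

Lemma ideal_m : ideal (fun x => x \in m).
Proof.
split=> [|a x y]; rewrite !resk.2 ?rmorph0 //.
by rewrite rmorphD rmorphM => /eqP -> /eqP ->; rewrite mulr0 addr0.
Qed.

Lemma residue_inv a : a \notin m -> exists b, 1 - a * b \in m.
Proof.
rewrite resk.2 => a0; have [b hb] := resk.1 (pi a)^-1; exists b.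
by rewrite resk.2 rmorphB rmorphM hb rmorph1 divff // subrr.
Qed.

Lemma residue_root e a : exists a', a - a' ^+ (p ^ e) \in m.
Proof.
have [x hx] := closedk (fun i => if i == 0%N then pi a else 0) (q_gt0 e).
have [a' ha'] := resk.1 x; exists a'; rewrite resk.2 rmorphB rmorphXn ha' hx.
rewrite -(prednK (q_gt0 e)) big_ord_recl /= mulr1 big1 ?addr0 ?subrr //.
by move=> i _; rewrite mul0r.
Qed.

Lemma frobD e (x y : B) : (x + y) ^+ (p ^ e) = x ^+ (p ^ e) + y ^+ (p ^ e).
Proof. exact: (rmorphD (frobenius_iter pcharB e)). Qed.
Lemma frobB e (x y : B) : (x - y) ^+ (p ^ e) = x ^+ (p ^ e) - y ^+ (p ^ e).
Proof. exact: (rmorphB (frobenius_iter pcharB e)). Qed.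

(** Multiplication by [t] shifts the coefficients; the last one produces
    [d ^ q t ^ q = (t d) ^ q], which is moved to degree [0]. *)
Lemma frobenius_basis_step e (t x b : B) :
  (exists d : 'I_(p ^ e) -> B, b = \sum_j d j ^+ (p ^ e) * t ^+ j) ->
  exists d : 'I_(p ^ e) -> B, x ^+ (p ^ e) + t * b = \sum_j d j ^+ (p ^ e) * t ^+ j.
Proof.
move=> [d ->]; pose q1 := (p ^ e).-1.
have eq : (p ^ e = q1.+1)%N by rewrite prednK // q_gt0.
pose d' i := if insub i is Some o then d o else 0.
have ed i : d i = d' (val i) by rewrite /d' valK.
exists (fun j => if val j is j'.+1 then d' j' else x + t * d' q1).
transitivity (x ^+ (p ^ e) + t * \sum_(j < q1.+1) d' j ^+ (p ^ e) * t ^+ j).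
  rewrite -eq; congr (_ + _ * _); apply: eq_bigr => j _; by rewrite ed.
transitivity (\sum_(j < q1.+1)
    (if val j is j'.+1 then d' j' else x + t * d' q1) ^+ (p ^ e) * t ^+ j); last by rewrite -eq.
rewrite big_ord_recr [RHS]big_ord_recl /= mulr1 frobD -addrA; congr (_ + _).
rewrite mulrDr addrC exprMn mulrCA -exprS -eq; congr (_ + _); last exact: mulrC.
rewrite mulr_sumr; apply: eq_bigr => j _.
by rewrite /bump leq0n add1n mulrCA -exprS.
Qed.

Section WithUniformizer.
Variables (t : B) (c : nat).
Hypothesis ut : uniformizer t c.

(** [t] is prime: modulo [t], every element of [B] is congruent to an element
    of [A], which either lies in [m] or is invertible modulo [m]. *)
Lemma uni_prime e (b z : B) : b ^+ (p ^ e) = t * z -> exists b', b = t * b'.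
Proof.
have [a [b' ->]] := uni_residue ut b; rewrite frobD => ez.
have [am|/residue_inv [a' haa]] := boolP (a \in m).
  by have [b2 ->] := uni_max ut am; exists (b2 + b'); rewrite mulrDr.
exfalso; have [w] := uni_max ut haa; rewrite rmorphB rmorphM rmorph1 => ew.
have {}ew : to_ic a * to_ic a' = 1 - t * w by rewrite -ew opprB addrC subrK.
have [s es] : exists s, (t : B) ^+ (p ^ e) = t * s.
  by exists (t ^+ (p ^ e).-1); rewrite -exprS prednK ?q_gt0.
have {}ez : to_ic a ^+ (p ^ e) = t * (z - s * b' ^+ (p ^ e)).
  by rewrite mulrBr -ez exprMn es mulrA addrK.
have := congr1 (fun x => x ^+ (p ^ e)) ew.
rewrite /= frobB expr1n !exprMn ez es => e1.
have := uni_nonunit ut ((z - s * b' ^+ (p ^ e)) * to_ic a' ^+ (p ^ e) + s * w ^+ (p ^ e)).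
by rewrite mulrDr !mulrA e1 subrK eqxx.
Qed.

(** Comparing lowest terms, one [j] after the other, shows that [t] divides all
    [d j].  The relation can then be divided by [t ^ q], and so on forever. *)
Lemma frobenius_independent e (d : 'I_(p ^ e) -> B) :
  \sum_j d j ^+ (p ^ e) * t ^+ j = 0 -> forall j, d j = 0.
Proof.
have step (f : 'I_(p ^ e) -> B) : \sum_j f j ^+ (p ^ e) * t ^+ j = 0 ->
    forall j, exists z, f j = t * z.
  move=> ef j; have [N ltN] := ubnP (val j); elim: N => // N IHN in j ltN *.
  have : exists z, f j ^+ (p ^ e) * t ^+ j = t ^+ j.+1 * z.
    move: ef; rewrite (bigD1 j) //= => /eqP; rewrite addr_eq0 => /eqP ->.
    have : forall l, exists z, l != j -> - (f l ^+ (p ^ e) * t ^+ l) = t ^+ j.+1 * z.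
      move=> l; have [->|lj] := eqVneq l j; first by exists 0.
      have [llj|jl] := ltnP l j.
        have [|z ->] := IHN l; first exact: leq_trans llj _.
        exists (- (t ^+ (p ^ e - j.+1) * z ^+ (p ^ e) * t ^+ l)) => _.
        by rewrite exprMn -{1}(subnKC (ltn_ord j)) exprD mulrN !mulrA.
      exists (- (f l ^+ (p ^ e) * t ^+ (l - j.+1))) => _.
      rewrite mulrN mulrCA -exprD subnKC // ltn_neqAle eq_sym; apply/andP; split=> //.
    move=> /choice [z hz]; exists (\sum_(l | l != j) z l).
    by rewrite -sumrN mulr_sumr; apply: eq_bigr.
  move=> [z ez]; apply: (@uni_prime e _ z).
  apply: (mulIf (expf_neq0 j (uni_neq0 ut))).
  by rewrite ez exprS mulrAC.
move=> ed j; apply: (uni_separated ut) => n; elim: n => [|n IHn] in d ed *.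
  by exists (d j); rewrite mul1r.
have [d' hd'] := choice (step d ed).
have [|z hz] := IHn d'; last by exists z; rewrite hd' hz exprS mulrA.
apply: (mulfI (expf_neq0 (p ^ e) (uni_neq0 ut))); rewrite mulr0 -[RHS]ed mulr_sumr.
by apply: eq_bigr => i _; rewrite (hd' i) exprMn mulrA.
Qed.

(** [B] is isomorphic to the ideal [t ^ c B] of [A]. *)
Lemma integral_closure_gen : exists (T : finType) (g : T -> B),
  forall b, exists d : T -> A, b = \sum_i d i *: g i.
Proof.
pose I (a : A) := exists b, to_ic a = t ^+ c * b.
have iI : ideal I.
  split; first by exists 0; rewrite rmorph0 mulr0.
  move=> a x y [u eu] [v ev]; exists (to_ic a * u + v).
  by rewrite rmorphD rmorphM /= eu ev mulrDr mulrCA.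
have [n [g [gI gen]]] := noeth_fg noeA iI; have [h eh] := choice gI.
exists 'I_n, h => b; have [a ea] := uni_conductor ut b.
have [d ed] := gen a (ex_intro _ b ea); exists d.
apply: (mulfI (expf_neq0 c (uni_neq0 ut))).
rewrite -ea ed rmorph_sum mulr_sumr; apply: eq_bigr => i _.
by rewrite rmorphM /= eh ic_scaleE mulrCA.
Qed.

Section Exponent.
Variable e : nat.
Hypothesis ce : (c <= p ^ e)%N.

(** For [q >= c] the [q]-th powers of [B] lie in [A]: writing [b = a + t b'],
    the power [t ^+ q * b' ^+ q] lies in the conductor. *)
Lemma frobenius_into : exists phi : {rmorphism B -> A},
  forall b, to_ic (phi b) = b ^+ (p ^ e).
Proof.
have /choice [f hf] : forall b : B, exists a : A, to_ic a = b ^+ (p ^ e).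
  move=> b; have [a [b' ->]] := uni_residue ut b.
  have [a' ha'] := uni_conductor ut (t ^+ (p ^ e - c) * b' ^+ (p ^ e)).
  exists (a ^+ (p ^ e) + a'); rewrite rmorphD rmorphXn /= ha' frobD exprMn mulrA.
  by rewrite -exprD subnKC.
have zf : zmod_morphism f by move=> x y; apply: to_ic_inj; rewrite rmorphB /= !hf frobB.
have mf : monoid_morphism f.
  split=> [|x y]; apply: to_ic_inj; first by rewrite rmorph1 hf expr1n.
  by rewrite rmorphM /= !hf exprMn.
pose phi : {rmorphism B -> A} := HB.pack f
  (GRing.isZmodMorphism.Build B A f zf) (GRing.isMonoidMorphism.Build B A f mf).
by exists phi.
Qed.

Variable phi : {rmorphism B -> A}.
Hypothesis phiE : forall b, to_ic (phi b) = b ^+ (p ^ e).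

Lemma phi_to a : phi (to_ic a) = a ^+ (p ^ e).
Proof. by apply: to_ic_inj; rewrite phiE rmorphXn. Qed.

Lemma phi_inj b : phi b = 0 -> b = 0.
Proof.
by move/(congr1 to_ic); rewrite phiE rmorph0 => /eqP; rewrite expf_eq0 => /andP[_ /eqP].
Qed.

Lemma conductor_basis : exists tau : 'I_(p ^ e) -> A,
  (forall j, to_ic (tau j) = t ^+ (c + j)) /\
  forall x b, to_ic x = t ^+ c * b ->
    exists d : 'I_(p ^ e) -> B, x = \sum_j phi (d j) * tau j.
Proof.
have [tau htau] := choice (fun j : 'I_(p ^ e) => uni_conductor ut (t ^+ j)).
exists tau; split=> [j|x b ex]; first by rewrite htau exprD.
have [d ed] := uni_frobenius ut e b; exists d; apply: to_ic_inj.
rewrite ex ed rmorph_sum mulr_sumr; apply: eq_bigr => j _.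
by rewrite rmorphM /= phiE htau mulrCA.
Qed.

(** [A / m ^ c] is spanned by finitely many elements with [q]-th powers as
    coefficients, and [m ^ c] lies in [t ^ c B], which is generated over the
    [q]-th powers of [B] by the [t ^ (c + j)]. *)
Lemma ring_gen_over_phi : exists (T : finType) (v : T -> A),
  forall x, exists b : T -> B, x = \sum_i phi (b i) * v i.
Proof.
have [n [g [gm gen]]] := noeth_fg noeA ideal_m.
have [|T [v hv]] := span_mod_pow (Q := fun a => exists a', a = a' ^+ (p ^ e)) gm gen _ c.
  by move=> x; have [a' ha'] := residue_root e x; exists (a' ^+ (p ^ e)) => //; exists a'.
have [tau [htau genc]] := conductor_basis.
exists (T + 'I_(p ^ e))%type, (fun i => match i with inl i => v i | inr j => tau j end).
move=> x; have [a [/choice [a' ha'] hJ]] := hv x.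
pose J y := exists b, to_ic y = t ^+ c * b.
have [||b eb] := hJ J.
- split; first by exists 0; rewrite rmorph0 mulr0.
  move=> s y z [u eu] [w ew]; exists (to_ic s * u + w).
  by rewrite rmorphD rmorphM /= eu ew mulrDr mulrCA.
- rewrite /J; elim: {hJ hv} c => [|n' IH] s.
    by move/size0nil ->; exists 1; rewrite big_nil rmorph1 expr0 mulr1.
  case: s => // y s [ss] sm; rewrite big_cons.
  have [b eb] := uni_max ut (sm y (mem_head _ _)).
  have [|b' eb'] := IH s ss.
    by move=> z zs; apply: sm; rewrite inE zs orbT.
  by exists (b * b'); rewrite rmorphM /= eb eb' exprS; ring.
have [d ed] := genc _ _ eb.
exists (fun i => match i with inl i => to_ic (a' i) | inr j => d j end).
rewrite big_sumType /= -ed; apply/eqP; rewrite addrC -subr_eq; apply/eqP; congr (_ - _).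
by apply: eq_bigr => i _; rewrite phi_to -ha'.
Qed.

Variable M : lmodType A.
Hypothesis fgM : fin_gen M.

Definition phi_module : lmodType B := restrict_scalars phi M.

Lemma phi_scaleE (b : B) (y : phi_module) : b *: y = (phi b *: (y : M) : M).
Proof. by []. Qed.

Lemma phi_module_gen : exists n (w : 'I_n -> M), forall y : M,
  exists b : 'I_n -> B, y = \sum_i phi (b i) *: w i.
Proof.
have [T [v hv]] := ring_gen_over_phi; have [n [g hg]] := fgM.
have [s [w hw]] : fin_gen phi_module.
  apply: (@fin_genI _ phi_module (T * 'I_n)%type (fun ij => v ij.1 *: g ij.2 : M)) => y.
  have [x ex] := (hg y).1 isT; have [b hb] := choice (fun i => hv (x i)).
  exists (fun ij => b ij.2 ij.1).
  rewrite {1}ex -(pair_bigA _ (fun i j => b j i *: (v i *: g j : phi_module))) /= exchange_big.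
  apply: eq_bigr => j _; rewrite {1}hb scaler_suml; apply: eq_bigr => i _.
  by rewrite phi_scaleE scalerA.
by exists s, w => y; have [b ->] := (hw y).1 isT; exists b.
Qed.

Lemma phi_torsion (y : M) : torsion (y : phi_module) <-> torsion y.
Proof.
split=> [[b b0 by0]|[a a0 ay]].
  by exists (phi b) => //; apply: contraNneq b0 => /phi_inj ->.
exists (to_ic a); first by rewrite to_ic_eq0.
have : phi (to_ic a) *: y = 0 :> M.
  by rewrite phi_to -(prednK (q_gt0 e)) exprSr -scalerA ay scaler0.
by [].
Qed.

(** [B] is free of rank [q] over its [q]-th powers, with basis the [t ^ j].
    So if [u] is a basis of [M] modulo torsion over [A], then the products
    [tau j * u i] form one of [M] as a [B]-module through [phi]. *)
Lemma phi_rank r n (w : 'I_n -> phi_module) : has_rank M r ->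
  (forall y, exists d : 'I_n -> B, torsion (y - \sum_i d i *: w i)) ->
  (forall d : 'I_n -> B, torsion (\sum_i d i *: w i) -> forall i, d i = 0) ->
  n = (r * p ^ e)%N.
Proof.
move=> rk gen indw; have [u [iu su]] := rank_basis fgM rk.
have [tau [htau genc]] := conductor_basis.
pose x (ij : 'I_r * 'I_(p ^ e)) : phi_module := (tau ij.2 *: u ij.1 : M).
have sumx (d : 'I_r * 'I_(p ^ e) -> B) :
    \sum_ij d ij *: x ij = \sum_i (\sum_j phi (d (i, j)) * tau j) *: u i.
  rewrite (_ : \sum_ij d ij *: x ij = \sum_i \sum_j d (i, j) *: x (i, j)); last first.
    by rewrite pair_bigA; apply: eq_bigr => -[].
  apply: eq_bigr => i _; rewrite scaler_suml; apply: eq_bigr => j _.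
  by rewrite phi_scaleE scalerA.
have ix : independent x.
  move=> d; rewrite sumx => /iu h [i j].
  move: j; apply: frobenius_independent.
  apply: (mulfI (expf_neq0 c (uni_neq0 ut))); rewrite mulr0.
  transitivity (to_ic (\sum_j phi (d (i, j)) * tau j)); last by rewrite h rmorph0.
  rewrite rmorph_sum mulr_sumr; apply: eq_bigr => j _.
  by rewrite rmorphM /= phiE htau exprD mulrCA.
have sx (y : phi_module) : tspan x y.
  have [a a0 [f ef]] := su y.
  have b0 : t ^+ c * to_ic a != 0.
    by apply: mulf_neq0; [apply: expf_neq0; exact: uni_neq0 ut | rewrite to_ic_eq0].
  exists (t ^+ c * to_ic a) => //.
  have /choice [d hd] : forall i, exists d : 'I_(p ^ e) -> B,
      phi (t ^+ c) * a ^+ (p ^ e).-1 * f i = \sum_j phi (d j) * tau j.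
    move=> i; apply: (genc _ (t ^+ (c * (p ^ e).-1) * to_ic (a ^+ (p ^ e).-1 * f i))).
    by rewrite -mulrA rmorphM /= phiE -exprM mulrA -exprD -mulnS prednK ?q_gt0.
  exists (fun ij => d ij.1 ij.2); rewrite sumx phi_scaleE rmorphM /= phi_to.
  have -> : a ^+ (p ^ e) = a ^+ (p ^ e).-1 * a by rewrite -exprSr prednK ?q_gt0.
  rewrite mulrA -scalerA ef scaler_sumr.
  by apply: eq_bigr => i _; rewrite scalerA hd.
have iw : independent w by move=> d h; apply: indw; rewrite h; apply: torsion0.
have sw y : tspan w y.
  have [d [b b0 hb]] := gen y; exists b => //; exists (fun i => b * d i).
  move/eqP: hb; rewrite scalerBr subr_eq0 => /eqP ->; rewrite scaler_sumr.
  by apply: eq_bigr => i _; rewrite scalerA.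
apply/eqP; rewrite eqn_leq.
have := independent_card iw (fun i => sx (w i)); rewrite card_prod !card_ord => ->.
by have := independent_card ix (fun i => sw (x i)); rewrite card_prod !card_ord.
Qed.

Lemma frobenius_module_gen : fin_gen (frobenius_module pcharA e M).
Proof.
have [n [w hw]] := phi_module_gen; have [T [g hg]] := integral_closure_gen.
apply: (@fin_genI _ (frobenius_module pcharA e M) (T * 'I_n)%type (fun ij => phi (g ij.1) *: w ij.2 : M)) => y.
have [b eb] := hw y; have [d hd] := choice (fun i => hg (b i)).
exists (fun ij => d ij.2 ij.1); rewrite {1}eb.
rewrite (_ : \sum_(ij : T * 'I_n) _ = \sum_i \sum_j (d j i ^+ (p ^ e) *: (phi (g i) *: w j) : M)); last first.
  by rewrite pair_bigA; apply: eq_bigr => -[].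
rewrite exchange_big; apply: eq_bigr => j _ /=.
rewrite {1}hd rmorph_sum scaler_suml; apply: eq_bigr => i _.
by rewrite ic_scaleE rmorphM /= phi_to scalerA.
Qed.

(** Modulo its torsion, the [B]-module [M] is free; the torsion is [H0 m M], a
    vector space over the residue field.  Lifting a basis of the free part
    gives the splitting. *)
Lemma frobenius_module_iso r l : (l <= p ^ e)%N ->
  (forall y : M, torsion y -> y \in H0 m M) ->
  (exists2 a, a \in m & a != 0) ->
  has_rank M r -> has_length (H0 m M) l ->
  lmod_iso (frobenius_module pcharA e M)
     (({ffun 'I_(r * p ^ e) -> B} * {ffun 'I_l -> residue_module pi})%type : lmodType A).
Proof.
move=> le torH [a0 a0m a0n0] rk len.
have H0tor y : y \in H0 m M -> torsion y.
  move=> /asboolP [n hn]; exists (a0 ^+ n); first exact: expf_neq0.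
  by apply: hn; apply: ideal_powX.
have [y [kill yH gen ind]] := residue_basis (fun a b => idealM b ideal_m) residue_inv
  len (q_gt0 e) le (residue_root e).
have [n0 [w0 gen0]] := phi_module_gen.
have [n [w [genw indw]]] : exists n (w : 'I_n -> phi_module),
    (forall y, exists c : 'I_n -> B, torsion (y - \sum_i c i *: w i)) /\
    (forall c : 'I_n -> B, torsion (\sum_i c i *: w i) -> forall i, c i = 0).
  apply: (@free_mod_torsion _ phi_module n0 w0 (uni_euclidean ut)) => z.
  by have [d ed] := gen0 z; exists d; rewrite {1}ed subrr; apply: torsion0.
have en := phi_rank rk genw indw; subst n.
have [sec secK] := choice resk.1.
apply: lmod_iso_sym.
have fD (u v : A) : (u + v) ^+ (p ^ e) = u ^+ (p ^ e) + v ^+ (p ^ e).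
  exact: (rmorphD (frobenius_iter pcharA e)).
have fB (u v : A) : (u - v) ^+ (p ^ e) = u ^+ (p ^ e) - v ^+ (p ^ e).
  exact: (rmorphB (frobenius_iter pcharA e)).
have secq a z : z \in H0 m M -> sec (pi a) ^+ (p ^ e) *: z = a ^+ (p ^ e) *: z.
  move=> zH; apply/eqP; rewrite -subr_eq0 -scalerBl; apply/eqP.
  rewrite -fB; apply: kill => //.
  by rewrite resk.2 rmorphB secK subrr.
pose D := ({ffun 'I_(r * p ^ e) -> B} * {ffun 'I_l -> residue_module pi})%type.
pose f (x : D) : M := \sum_i phi (x.1 i) *: (w i : M) + \sum_j sec (x.2 j) ^+ (p ^ e) *: y j.
have lf : linear (f : (D : lmodType A) -> frobenius_module pcharA e M).
  move=> a x x'; rewrite /f.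
  have -> : \sum_i phi ((a *: x + x').1 i) *: (w i : M) =
      a ^+ (p ^ e) *: \sum_i phi (x.1 i) *: (w i : M) + \sum_i phi (x'.1 i) *: (w i : M).
    rewrite scaler_sumr -big_split; apply: eq_bigr => i _ /=.
    by rewrite !ffunE /= ic_scaleE rmorphD rmorphM /= phi_to scalerDl scalerA.
  have -> : \sum_j sec ((a *: x + x').2 j) ^+ (p ^ e) *: y j =
      a ^+ (p ^ e) *: \sum_j sec (x.2 j) ^+ (p ^ e) *: y j
        + \sum_j sec (x'.2 j) ^+ (p ^ e) *: y j.
    rewrite scaler_sumr -big_split; apply: eq_bigr => j _ /=.
    have -> : (a *: x + x').2 j = pi (a * sec (x.2 j) + sec (x'.2 j)).
      by rewrite /= !ffunE rmorphD rmorphM !secK.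
    by rewrite secq // fD exprMn scalerDl -scalerA.
  by rewrite addrACA -scalerDr.
apply: (lmod_iso_intro lf).
  have f0 x : f x = 0 -> x = 0.
    move=> fx; have tors : torsion (\sum_j sec (x.2 j) ^+ (p ^ e) *: y j).
      by apply: torsion_sum => j _; apply: torsionZ; apply: H0tor.
    have x1 : forall i, x.1 i = 0.
      apply: indw; apply/phi_torsion; move/eqP: fx; rewrite addr_eq0 => /eqP ->.
      exact: torsionN.
    have x2 : forall j, sec (x.2 j) \in m.
      apply: ind; move: fx; rewrite /f big1 ?add0r // => i _.
      by rewrite x1 rmorph0 scale0r.
    case: x {fx tors} x1 x2 => x1 x2 /= h1 h2; congr (_, _); apply/ffunP => i.
      by rewrite h1 ffunE.
    by have := h2 i; rewrite resk.2 secK ffunE => /eqP.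
  move=> x x' /eqP; rewrite -subr_eq0 => /eqP h.
  apply/eqP; rewrite -subr_eq0; apply/eqP; apply: f0.
  by rewrite -[x - x']addrC -scaleN1r (lf (-1) x' x) scaleN1r addrC.
move=> z; have [d hd] := genw z; have tz := (phi_torsion _).1 hd.
have [a ha] := gen _ (torH _ tz).
exists ([ffun i => d i], [ffun j => pi (a j)]); rewrite /f /=.
under [X in _ + X]eq_bigr => j _ do rewrite ffunE secq //.
rewrite -ha addrC; under [X in _ + X]eq_bigr => j _ do rewrite ffunE.
exact: subrK.
Qed.

End Exponent.

Lemma frobenius_module_gen_le e e' (M : lmodType A) : (e <= e')%N ->
  fin_gen (frobenius_module pcharA e' M) -> fin_gen (frobenius_module pcharA e M).
Proof.
move=> le [n [g hg]]; apply: (@fin_genI _ (frobenius_module pcharA e M) 'I_n g) => x.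
have [d ed] := (hg x).1 isT; exists (fun i => d i ^+ (p ^ (e' - e))).
rewrite {1}ed; apply: eq_bigr => i _.
rewrite /GRing.scale /= /restrict_scale /= /frobenius_iter.
by rewrite -exprM -expnD subnK.
Qed.

(** Finite F-representation type follows by adding the finitely many modules
    [frobenius_module pcharA j M] with [j < e0] to the list of summands.  They
    are finitely generated because generators for a larger exponent are also
    generators for a smaller one. *)
Theorem frobenius_decomposition (M : lmodType A) r l : fin_gen M ->
  (forall y : M, torsion y -> y \in H0 m M) ->
  (exists2 a, a \in m & a != 0) ->
  has_rank M r -> has_length (H0 m M) l ->
  (exists e0 : nat, forall e : nat, (e0 <= e)%N ->
     lmod_iso (frobenius_module pcharA e M)
       (({ffun 'I_(r * p ^ e) -> integral_closure A}
         * {ffun 'I_l -> residue_module pi})%type : lmodType A)) /\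
  FFRT pcharA M.
Proof.
move=> fgM torH mn0 rk len; pose e0 := maxn c l.
have p1 : (1 < p)%N by apply: prime_gt1; case/andP: pcharA.
have big e : (e0 <= e)%N -> (c <= p ^ e)%N /\ (l <= p ^ e)%N.
  move=> h; have := ltnW (ltn_expl e p1).
  by split; apply: leq_trans _ (leq_trans h _); rewrite ?leq_maxl ?leq_maxr.
have iso e : (e0 <= e)%N -> lmod_iso (frobenius_module pcharA e M)
       (({ffun 'I_(r * p ^ e) -> integral_closure A}
         * {ffun 'I_l -> residue_module pi})%type : lmodType A).
  move=> /big [ce le]; have [phi phiE] := frobenius_into ce.
  exact: (frobenius_module_iso phiE).
have fg e : (e <= e0)%N -> fin_gen (frobenius_module pcharA e M).
  have [ce le] := big e0 (leqnn _); have [phi phiE] := frobenius_into ce.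
  by move=> ee0; apply: (frobenius_module_gen_le ee0); apply: (frobenius_module_gen phiE).
split; first by exists e0.
pose N (i : 'I_(e0.+2)) : lmodType A := match val i with
  | 0 => integral_closure A | 1 => residue_module pi
  | j.+2 => frobenius_module pcharA j M end.
exists e0.+2, N; split.
  move=> [[|[|j]] hj]; rewrite /N /=.
  - by have [T [g hg]] := integral_closure_gen; apply: (fin_genI hg).
  - apply: (@fin_genI _ _ 'I_1 (fun=> (1 : k) : residue_module pi)) => x.
    have [a ha] := resk.1 x; exists (fun=> a); rewrite big_ord1.
    by have e : (x : k) = pi a * 1 by rewrite ha mulr1.
  - by apply: fg; rewrite -ltnS ltnW.
move=> e; have [ee0|ee0] := leqP e0 e.
  exists (fun i => match val i with 0 => r * p ^ e | 1 => l | _ => 0 end)%N.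
  apply: lmod_iso_trans (iso e ee0) _; apply: lmod_iso_sym.
  apply: (@dirsum_two _ _ N _ (@Ordinal e0.+2 0 isT) (@Ordinal e0.+2 1 isT)) => //.
  by move=> [[|[|j]] hj].
exists (fun i => match val i with j.+2 => nat_of_bool (j == e) | _ => 0 end)%N.
have he : (e.+2 < e0.+2)%N by [].
apply: lmod_iso_sym.
apply: (lmod_iso_trans (@dirsum_one _ _ N _ (Ordinal he) _)).
  move=> [[|[|j]] hj] //= ne; case: eqP => // ej; case/eqP: ne.
  by apply: val_inj; rewrite /= ej.
by apply: lmod_iso_ffun1; rewrite /= eqxx.
Qed.

End WithUniformizer.
End Uniformizer.

(** * The complete local case *)

Section PowersOfMaximalIdeal.
Variable R : comNzRingType.
Implicit Types (m : {pred R}) (I : R -> Prop).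

Lemma pow_in_weaken m N n I : ideal I -> (N <= n)%N -> pow_in m N I -> pow_in m n I.
Proof.
move=> iI /subnKC <- h s ss sm; rewrite -(cat_take_drop N s) big_cat /=.
apply: idealMr => //; apply: h; first by rewrite size_takel // ss leq_addr.
by move=> x /mem_take; apply: sm.
Qed.

Lemma pow_in_exp m N n (x : R) : pow_in m N (fun y => exists z, y = x * z) ->
  pow_in m (n * N) (fun y => exists z, y = x ^+ n * z).
Proof.
move=> h; elim: n => [|n IHn] s ss sm; first by exists (\prod_(y <- s) y); rewrite mul1r.
rewrite -(cat_take_drop N s) big_cat /=.
have [||z1 ->] := h (take N s).
- by rewrite size_takel // ss mulSn leq_addr.
- by move=> y /mem_take; apply: sm.
have [||z2 ->] := IHn (drop N s).
- by rewrite size_drop ss mulSn addKn.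
- by move=> y /mem_drop; apply: sm.
by exists (z1 * z2); rewrite exprS; ring.
Qed.

Lemma pow_in_expr m N I x : x \in m -> pow_in m N I -> I (x ^+ N).
Proof.
move=> xm h; rewrite -iter_mulr_1 -(big_nseq _ _ N x id).
by apply: h; [rewrite size_nseq | move=> y /nseqP [-> _]].
Qed.

End PowersOfMaximalIdeal.

Section DimensionOne.
Variables (A : idomainType) (m : {pred A}) (k : fieldType) (pi : {rmorphism A -> k}).
Hypotheses (dim1 : krull_dim A 1) (resk : residue_field m pi).

Lemma one_notin_m : 1 \notin m.
Proof. by rewrite resk.2 rmorph1 oner_eq0. Qed.

(** Otherwise [0], [P] and [m] form a chain of primes of length two. *)
Lemma dim_one_prime (P : A -> Prop) : ideal P -> ~ P 1 ->
  (forall y z, P (y * z) -> P y \/ P z) -> (exists2 a, P a & a != 0) ->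
  (forall x, P x -> x \in m) -> forall x, x \in m -> P x.
Proof.
move=> iP P1 pP [a Pa a0] Pm x xm; apply: contrapT => nPx; case: dim1.2.
pose C i : {pred A} := match i with
  | 0 => pred1 0 | 1 => fun x => `[< P x >] | _ => m end.
have im := ideal_m resk.
exists C; split=> [[|[|[|i]]] // _|[|[|i]] // _].
- split; first split; rewrite ?inE ?oner_neq0 //.
    by move=> b u v; rewrite !inE => /eqP-> /eqP->; rewrite mulr0 addr0.
  by move=> u v; rewrite !inE mulf_eq0.
- split; first split.
  + by apply/asboolP; exact: iP.1.
  + by apply/negP => /asboolP.
  + by move=> b u v /asboolP Pu /asboolP Pv; apply/asboolP; apply: iP.2.
  by move=> u v /asboolP /pP [] h; apply/orP; [left|right]; apply/asboolP.
- split; first split.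
  + exact: im.1.
  + exact: one_notin_m.
  + by move=> b u v um vm; apply: im.2.
  by move=> u v; rewrite /= !resk.2 rmorphM mulf_eq0.
- split; first by move=> y; rewrite inE => /eqP ->; apply/asboolP; exact: iP.1.
  by move=> /(_ a (introT (asboolP _) Pa)); rewrite inE (negPf a0).
- split; first by move=> y /asboolP /Pm.
  by move=> /(_ x xm) /asboolP.
Qed.

(** If [m] were zero, [A] would be a field, of dimension zero. *)
Lemma m_neq0 : exists2 a, a \in m & a != 0.
Proof.
have [[P [prP chP]] _] := dim1.
have [[P00 _ _] _] := prP 0%N isT; have [[P10 P11 P1i] _] := prP 1%N isT.
have [_ nsub] := chP 0%N isT.
have [x xP1 x0] : exists2 x, x \in P 1%N & x != 0.
  apply: contrapT => h; apply: nsub => x xP1; have [->//|x0] := eqVneq x 0.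
  by case: h; exists x.
apply: contrapT => h.
have m0 y : y \in m -> y = 0.
  by move=> ym; apply/eqP; apply: contrapT => /negP y0; apply: h; exists y.
have [b /m0 /eqP] : exists b, 1 - x * b \in m.
  by apply: (residue_inv resk); apply: contraNN x0 => /m0 ->.
rewrite subr_eq0 => /eqP e1; case/negP: P11; rewrite e1 mulrC -[b * x]addr0.
exact: P1i.
Qed.

End DimensionOne.

Lemma closed_field_split (k : fieldType) (P : {poly k}) : GRing.closed_field_axiom k ->
  P \is monic -> exists s : seq k, P = \prod_(a <- s) ('X - a%:P).
Proof.
move=> cl; have [n] := ubnP (size P); elim: n P => // n IHn P ltP mP.
have [s1|s1] := leqP (size P) 1.
  exists [::]; rewrite big_nil; move: mP; rewrite (size1_polyC s1) monicE lead_coefC.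
  by move=> /eqP ->.
have n0 : (0 < (size P).-1)%N by case: (size P) s1 => [|[]].
have [x hx] := cl _ (fun i => - P`_i) n0.
have rx : root P x.
  apply/eqP; rewrite horner_coef -(prednK (ltnW s1)) big_ord_recr /=.
  have -> : P`_(size P).-1 = 1 by exact/eqP.
  rewrite mul1r hx -big_split big1 //= => i _; by rewrite mulNr subrr.
have [Q eQ] := factor_theorem _ _ rx.
have mQ : Q \is monic by rewrite -(monicMr _ (monicXsubC x)) -eQ.
have [|s es] := IHn Q _ mQ.
  by move: ltP; rewrite eQ size_Mmonic ?monic_neq0 ?monicXsubC // size_XsubC addn2.
by exists (x :: s); rewrite big_cons eQ es mulrC.
Qed.

Section CompleteLocal.
Variables (A : idomainType) (p : nat) (pcharA : p \in [pchar A]).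
Variables (m : {pred A}) (k : fieldType) (pi : {rmorphism A -> k}).
Local Notation B := (integral_closure A).
Local Notation pcharB := (pchar_to_ic pcharA).
Hypotheses (noeA : noetherian A) (dim1 : krull_dim A 1).
Hypotheses (local_m : local_ring m) (complete_m : adic_complete m).
Hypotheses (resk : residue_field m pi) (closedk : GRing.closed_field_axiom k).

(** By Noetherian induction, a proper ideal lies in a maximal one. *)
Lemma proper_in_m (I : A -> Prop) : ideal I -> ~ I 1 -> forall x, I x -> x \in m.
Proof.
move: I; apply: noeth_ind => // I iI IH I1 x Ix.
have [[J [iJ J1 sIJ pIJ]]|nJ] := pselect (exists J : A -> Prop,
   [/\ ideal J, ~ J 1, forall x, I x -> J x & exists2 x, J x & ~ I x]).
  by apply: (IH J) => //; apply: sIJ.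
have maxI : maximal_ideal (fun x => `[< I x >]).
  split; first split.
  - by apply/asboolP; exact: iI.1.
  - by apply/negP => /asboolP.
  - by move=> b u v /asboolP Pu /asboolP Pv; apply/asboolP; apply: iI.2.
  move=> J [J0 J1 JD] sIJ y; apply/idP/asboolP => [yJ|Iy]; last first.
    by apply: sIJ; apply/asboolP.
  apply: contrapT => nIy; apply: nJ; exists (fun y => y \in J); split.
  - by split=> // a u v; apply: JD.
  - by apply/negP.
  - by move=> z Iz; apply: sIJ; apply/asboolP.
  - by exists y.
by rewrite -(local_m.2 _ maxI); apply/asboolP.
Qed.

Lemma unit_of_notin_m a : a \notin m -> exists b, a * b = 1.
Proof.
move=> am; apply: contrapT => h; case/negP: am.
apply: (proper_in_m (principal_ideal a)); last by exists 1; rewrite mulr1.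
by move=> [b e]; apply: h; exists b.
Qed.

Lemma pow_m_in (a : A) : a != 0 -> exists N, pow_in m N (fun x => exists y, x = a * y).
Proof.
move=> a0; apply: pow_in_of_primes => // P iP P1 pP Pa.
apply: (dim_one_prime dim1 resk iP P1 pP); first by exists a.
exact: proper_in_m.
Qed.

Lemma torsion_in_H0 (M : lmodType A) (y : M) : torsion y -> y \in H0 m M.
Proof.
move=> [a a0 ay]; have [N hN] := pow_m_in a0; apply/asboolP; exists N => b bN.
have [c ->] := pow_in_ideal_pow (principal_ideal a) hN bN.
by rewrite mulrC -scalerA ay scaler0.
Qed.

Lemma m_x_complete x : x \in m -> x != 0 -> x_complete x.
Proof.
move=> xm x0 u; have [N hN] := pow_m_in x0.
pose s n := \sum_(i < n) x ^+ i * u i.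
have [|y hy] := complete_m.2 s.
  move=> n; rewrite /s big_ord_recr /= addrC addrK.
  apply/asboolP; exists 1%N, (fun=> u n), (fun _ _ => x); split=> //.
  by rewrite big_ord1 prodr_const card_ord mulrC.
exists y => n; have ix := principal_ideal (x ^+ n).
have [z ez] := pow_in_ideal_pow ix
  (pow_in_weaken ix (leq_addr n _) (pow_in_exp hN)) (hy (n * N + n)%N).
have [z' ez'] : exists z', s (n * N + n)%N - s n = x ^+ n * z'.
  rewrite /s addnC big_split_ord /= [X in X - _]addrC addrK.
  exists (\sum_(i < n * N) x ^+ i * u (n + i)%N); rewrite mulr_sumr.
  by apply: eq_bigr => i _; rewrite exprD mulrA.
exists (z + z'); rewrite mulrDr -ez -ez' -/(s n); ring.
Qed.

Section WithNonunit.
Variable x : A.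
Hypotheses (xm : x \in m) (x0 : x != 0).
Local Notation X := (to_ic x).

Let X0 : X != 0. Proof. by rewrite to_ic_eq0. Qed.

Lemma x_nonunit (b : B) : X * b != 1.
Proof.
apply/eqP => /ic_unit_lift [a e]; case/negP: (one_notin_m resk).
by rewrite -e; apply: (idealMr _ (ideal_m resk)).
Qed.

Lemma x_power_multiple (a : A) : a != 0 -> exists N c, x ^+ N = a * c.
Proof. by move=> /pow_m_in [N /(pow_in_expr xm) [c e]]; exists N, c. Qed.

(** A nonzero [b] has a nonzero multiple [a] in [A], and [a] divides a power
    of [x]; if all powers of [x] divided [b], then [x] would be a unit. *)
Lemma ic_separated (b : B) : (forall n, exists z, b = X ^+ n * z) -> b = 0.
Proof.
move=> h; apply/eqP; apply: contrapT => /negP b0.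
have [a [a' [a0 e]]] := ic_denom b.
have a'0 : a' != 0.
  by rewrite -to_ic_eq0 -e; apply: mulf_neq0; rewrite ?to_ic_eq0.
have [N [c eN]] := x_power_multiple a'0.
have [z ez] := h N.+1.
have /negP := x_nonunit (z * to_ic a * to_ic c); apply; apply/eqP.
apply: (mulfI (expf_neq0 N X0)); rewrite mulr1 -[RHS](rmorphXn (to_ic)) eN rmorphM /= -e ez exprSr.
ring.
Qed.

(** The ideals [I n] of the [a] in [x ^ n B + x A] contain [x], so they become
    stationary; from there on [x ^ n B] is contained in [A + x ^ (n + 1) B]. *)
Lemma akizuki : exists n0, forall b : B, exists a b',
  X ^+ n0 * b = to_ic a + X ^+ n0.+1 * b'.
Proof.
pose I n (a : A) := exists (b : B) a', to_ic a = X ^+ n * b + X * to_ic a'.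
have dI n a : I n.+1 a -> I n a.
  by move=> [b [a' e]]; exists (X * b), a'; rewrite e exprSr mulrA.
have iI n : ideal (I n).
  split; first by exists 0, 0; rewrite !rmorph0 !mulr0 addr0.
  move=> a u v [b [a' eu]] [b' [a'' ev]].
  exists (to_ic a * b + b'), (a * a' + a'').
  by rewrite !rmorphD !rmorphM /= eu ev; ring.
have xI n a : (exists y, a = x * y) -> I n a.
  by move=> [y ->]; exists 0, y; rewrite mulr0 add0r rmorphM.
have [n0 st] := dcc noeA (residue_inv resk) (principal_ideal x) (pow_m_in x0) iI dI xI.
have dec n j a : I (n + j)%N a -> I n a.
  by elim: j => [|j IHj]; rewrite ?addn0 // addnS => /dI.
exists n0 => b.
pose Q n := exists a b', X ^+ n * b = to_ic a + X ^+ n.+1 * b'.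
have down j : Q (n0 + j)%N -> Q n0.
  elim: j => [|j IHj]; first by rewrite addn0.
  move=> [a [b' e]]; apply: IHj.
  have [|b2 [a2 e2]] := st (n0 + j.+2)%N (leq_addr _ _) a.
    apply: (dec _ j.+1); exists (b - X * b'), 0.
    by rewrite rmorph0 mulr0 addr0 mulrBr e mulrA -exprSr addrK.
  exists a2, (b' + b2); apply: (mulfI X0).
  rewrite addnS in e; rewrite mulrA -exprS e e2 !addnS !exprS; ring.
have [a [a' [a0 ea]]] := ic_denom b.
have [N [c eN]] := x_power_multiple a0.
apply: (down N); exists (x ^+ n0 * (c * a')), 0.
rewrite mulr0 addr0 exprD -[X ^+ N](rmorphXn to_ic) eN !rmorphM /= -ea rmorphXn /=; ring.
Qed.

(** Multiplication by [x ^ n0] identifies [B / x B] with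
    [x ^ n0 B / x ^ (n0 + 1) B], which is generated by finitely many elements
    of [A] in view of [akizuki]; Nakayama's lemma over the complete ring [A]
    lifts the generators. *)
Lemma ic_finite : exists n (g : 'I_n -> B), forall b, exists d : 'I_n -> A,
  b = \sum_i d i *: g i.
Proof.
have [n0 hn0] := akizuki.
pose D (a : A) := exists b, to_ic a = X ^+ n0 * b.
have iD : ideal D.
  split; first by exists 0; rewrite rmorph0 mulr0.
  move=> a u v [b eu] [b' ev]; exists (to_ic a * b + b').
  by rewrite rmorphD rmorphM /= eu ev; ring.
have [n [a [aD gen]]] := noeth_fg noeA iD; have [g eg] := choice aD.
exists n, g; apply: (complete_nakayama (m_x_complete xm x0)) => [b h|b].
  apply: ic_separated => l; have [z ez] := h l; exists z.
  by rewrite ez ic_scaleE rmorphXn.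
have [a1 [b' e]] := hn0 b.
have [|c ec] := gen a1.
  by exists (b - X * b'); rewrite mulrBr e mulrA -exprSr addrK.
exists c, b'; apply: (mulfI (expf_neq0 n0 X0)).
rewrite e mulrDr ec rmorph_sum mulr_sumr ic_scaleE mulrA -exprSr; congr (_ + _).
by apply: eq_bigr => i _; rewrite rmorphM /= eg ic_scaleE mulrCA.
Qed.

Lemma ic_conductor : exists c, forall b : B, exists a, to_ic a = X ^+ c * b.
Proof.
have [n [g hg]] := ic_finite.
have [w hw] := choice (fun i => ic_denom (g i)); have [w' hw'] := choice hw.
have [|N [c eN]] := @x_power_multiple (\prod_i w i).
  by apply/prodf_neq0 => i _; apply: (hw' i).1.
exists N => b; have [d ->] := hg b.
exists (\sum_i d i * (c * (\prod_(j | j != i) w j * w' i))).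
rewrite rmorph_sum mulr_sumr; apply: eq_bigr => i _.
rewrite -[X ^+ N](rmorphXn to_ic) ic_scaleE eN.
have -> : \prod_j w j = w i * \prod_(j | j != i) w j by rewrite (bigD1 i).
rewrite !rmorphM /= -(hw' i).2; ring.
Qed.

Lemma ic_x_complete : x_complete X.
Proof.
move=> u; have [n [g hg]] := ic_finite.
have [y hy] := x_complete_fg (m_x_complete xm x0) hg u.
exists y => l; have [z ez] := hy l; exists z; rewrite ez ic_scaleE rmorphXn.
by congr (_ + _); apply: eq_bigr => i _; rewrite ic_scaleE rmorphXn.
Qed.

(** The radical of [x B], described with [p]-power exponents so that the
    Frobenius homomorphism shows at once that it is an ideal. *)
Definition rad (b : B) : Prop := exists e b', b ^+ (p ^ e) = X * b'.

Lemma rad_ge b e : rad b -> exists e' b', (e <= e')%N /\ b ^+ (p ^ e') = X * b'.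
Proof.
move=> [e1 [b' h]]; exists (e1 + e)%N, (b' * (b ^+ (p ^ e1)) ^+ (p ^ e).-1).
rewrite leq_addl; split=> //.
by rewrite expnD exprM -{1}(prednK (q_gt0 pcharA e)) exprS {1}h mulrA.
Qed.

Lemma ideal_rad : ideal rad.
Proof.
split; first by exists 0%N, 0; rewrite expn0 expr1 mulr0.
move=> a u v [e [u' eu]] /(rad_ge e) [e' [v' [le ev]]].
exists e', (a ^+ (p ^ e') * (u' * (u ^+ (p ^ e)) ^+ (p ^ (e' - e)).-1) + v').
rewrite (frobD pcharA) exprMn ev mulrDr; congr (_ + _).
rewrite mulrCA; congr (_ * _).
rewrite -{1}(subnKC le) expnD exprM -{1}(prednK (q_gt0 pcharA (e' - e))) exprS {1}eu.
by rewrite mulrA.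
Qed.

Lemma rad_x b : rad (X * b).
Proof. by exists 0%N, b; rewrite expn0 expr1. Qed.

Lemma rad1 : ~ rad 1.
Proof. by move=> [e [b]]; rewrite expr1n => /esym /eqP; apply/negP/x_nonunit. Qed.

Let p1 : (1 < p)%N. Proof. by apply: prime_gt1; case/andP: pcharA. Qed.

Lemma rad_exp b n : rad (b ^+ n) -> rad b.
Proof.
move=> [e [b' h]]; exists (e + n)%N, (b' * b ^+ (p ^ (e + n) - n * p ^ e)).
have le : (n * p ^ e <= p ^ (e + n))%N.
  by rewrite expnD mulnC leq_mul2l (ltnW (ltn_expl n p1)) orbT.
by rewrite mulrA -h -exprM -exprD subnKC.
Qed.

Lemma rad_m a : a \in m -> rad (to_ic a).
Proof.
move=> am; have [N /(pow_in_expr am) [c e]] := pow_m_in x0.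
by apply: (@rad_exp _ N); rewrite -rmorphXn e rmorphM; apply: rad_x.
Qed.

(** Idempotents modulo the radical lift to [B] as limits of [p]-power
    sequences, and [B] is a domain. *)
Lemma rad_idempotent w : rad (w * (1 - w)) -> rad w \/ rad (1 - w).
Proof.
move=> [e [b0 e0]].
have [s es] : exists s, w ^+ p - w = w * (1 - w) * s.
  exists (- \sum_(i < p.-1) w ^+ i).
  have -> : w ^+ p - w = w * (w ^+ p.-1 - 1).
    by rewrite mulrBr mulr1 -exprS prednK // (ltnW p1).
  rewrite subrX1; ring.
(* [W] is a Cauchy sequence, and [W n * (1 - W n)] tends to zero. *)
pose W i := w ^+ (p ^ (e + i)).
have pown (b : B) n : exists z, b ^+ (p ^ n) = b ^+ n * z.
  exists (b ^+ (p ^ n - n)); rewrite -exprD subnKC //; exact: ltnW (ltn_expl n p1).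
have /choice [u hu] : forall i, exists z, W i.+1 - W i = X ^+ i * z.
  move=> i; have [z ez] := pown X i.
  exists (z * (b0 * s ^+ (p ^ e)) ^+ (p ^ i)).
  rewrite /W addnS expnS exprM -(frobB pcharA) es expnD exprM exprMn e0 -!mulrA exprMn ez.
  by rewrite mulrA.
have [y hy] := ic_x_complete u.
pose Y := y + W 0%N.
have hY n : exists z, Y = W n + X ^+ n * z.
  have [z ez] := hy n; exists z; rewrite /Y ez addrAC; congr (_ + _).
  elim: n {z ez} => [|n IHn]; first by rewrite big_ord0 add0r.
  by rewrite big_ord_recr /= -hu addrAC IHn addrC subrK.
have YY : Y * (1 - Y) = 0.
  apply: ic_separated => n; have [z ez] := hY n; have [z' ez'] := pown X n.
  exists (z' * b0 ^+ (p ^ n) + (z * (1 - W n) - W n * z - X ^+ n * z * z)).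
  have eW : W n * (1 - W n) = X ^+ n * (z' * b0 ^+ (p ^ n)).
    rewrite mulrA -ez' -exprMn -e0 -exprM -expnD exprMn (frobB pcharA) expr1n //.
  rewrite [RHS]mulrDr -eW ez; ring.
have [z ez] := hY 1%N.
move/eqP: YY; rewrite mulf_eq0 => /orP[] /eqP eY; [left|right].
  exists (e + 1)%N, (- z).
  by move/eqP: ez; rewrite eY eq_sym addr_eq0 expr1 -mulrN => /eqP.
exists (e + 1)%N, z; rewrite (frobB pcharA) expr1n.
move/eqP: eY; rewrite subr_eq0 => /eqP eY; rewrite eY ez expr1 -/(W 1%N); ring.
Qed.

Lemma rad_comaximal f g h r : rad (f * g) -> g = f * h + to_ic r -> r \notin m ->
  rad f \/ rad g.
Proof.
move=> rfg eg /unit_of_notin_m [r' rr].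
have rr' : to_ic r * to_ic r' = 1 by rewrite -rmorphM rr rmorph1.
pose w := g * to_ic r'.
have e1 : 1 - w = - (f * h * to_ic r') by rewrite /w eg mulrDl rr'; ring.
have [|rw|rw] := @rad_idempotent w.
- rewrite e1 (_ : _ * _ = (- h * to_ic r' ^+ 2) * (f * g)); last by rewrite /w; ring.
  exact: (idealM _ ideal_rad).
- by right; have := idealM (to_ic r) ideal_rad rw; rewrite /w mulrCA rr' mulr1.
left; have -> : f = to_ic r' * (f * g) + f * (1 - w) by rewrite /w; ring.
by apply: ideal_rad.2 => //; apply: (idealM _ ideal_rad).
Qed.

Lemma prod_sub_expand (b : B) a (s : seq A) : exists h,
  \prod_(c <- s) (b - to_ic c) = (b - to_ic a) * h + to_ic (\prod_(c <- s) (a - c)).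
Proof.
elim: s => [|c s [h IH]]; first by exists 0; rewrite !big_nil mulr0 add0r rmorph1.
exists (h * (b - to_ic c) + to_ic (\prod_(c <- s) (a - c))).
rewrite !big_cons IH rmorphM rmorphB; ring.
Qed.

(** Split off the factor [b - a].  If the product [r] of the [a - c] over the
    remaining roots is a unit, then [b - a] and the remaining product are
    comaximal; otherwise the remaining product is, modulo the radical, a
    multiple of [b - a], so its square lies in the radical. *)
Lemma rad_root b (s : seq A) : rad (\prod_(c <- s) (b - to_ic c)) ->
  exists a, rad (b - to_ic a).
Proof.
elim: s => [|a s IHs]; first by rewrite big_nil => /rad1.
have [h eh] := prod_sub_expand b a s.
rewrite big_cons; set g := \prod_(c <- s) (b - to_ic c) in eh IHs *.
set r := \prod_(c <- s) (a - c) in eh => rfg.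
have [rm|rm] := boolP (r \in m).
  apply: IHs; apply: (@rad_exp _ 2).
  have -> : g ^+ 2 = h * ((b - to_ic a) * g) + g * to_ic r by rewrite expr2 {2}eh; ring.
  by apply: ideal_rad.2 => //; apply: (idealM _ ideal_rad); apply: rad_m.
have [|rg] := rad_comaximal rfg eh rm; first by exists a.
exact: IHs.
Qed.

(** Modulo [m], a monic equation of [b] splits over the algebraically closed
    field [k]. *)
Lemma ic_residue b : exists a, rad (b - to_ic a).
Proof.
have [P [mP Pb]] := ic_monic b.
have [s es] := closed_field_split closedk (monic_map pi mP).
have [f hf] := choice resk.1.
pose Q := \prod_(a <- map f s) ('X - a%:P).
have eQ : map_poly pi Q = map_poly pi P.
  rewrite es rmorph_prod big_map; apply: eq_bigr => a _.
  by rewrite rmorphB /= map_polyX map_polyC /= hf.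
have Qb : (map_poly to_ic Q).[b] = \prod_(c <- map f s) (b - to_ic c).
  rewrite rmorph_prod horner_prod; apply: eq_bigr => a _.
  by rewrite rmorphB /= map_polyX map_polyC hornerXsubC.
have rc n : rad (map_poly to_ic (Q - P))`_n.
  rewrite coef_map; apply: rad_m.
  have := congr1 (fun F : {poly k} => F`_n) eQ; rewrite !coef_map /= => e.
  by rewrite resk.2 coefB rmorphB e subrr.
apply: (@rad_root _ (map f s)); rewrite -Qb -[_.[b]]subr0 -Pb -hornerN -hornerD -rmorphB.
by rewrite horner_coef; apply: (ideal_sum _ ideal_rad) => i _; apply: (idealMr _ ideal_rad).
Qed.

(** If [b = a + j] with [j] in the radical, a large power [b ^ q = a ^ q + j ^ q]
    lies in [A] and has the residue of [a ^ q]. *)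
Lemma rad_or_unit b : ~ rad b -> exists b', b * b' = 1.
Proof.
move=> nb; have [a ra] := ic_residue b; have [c hc] := ic_conductor.
have am : a \notin m.
  apply/negP => /rad_m am; apply: nb; rewrite -[b](subrK (to_ic a)).
  exact: (idealD ideal_rad).
have [e [b' ej]] := ra.
have [a' ea'] := hc (X ^+ (p ^ c.+1 - c.+1) * b' ^+ (p ^ c.+1)).
have eb : b ^+ (p ^ (e + c.+1)) = to_ic (a ^+ (p ^ (e + c.+1)) + x * a').
  rewrite -{1}[b](subrK (to_ic a)) (frobD pcharA) addrC rmorphD rmorphXn; congr (_ + _).
  rewrite expnD exprM ej exprMn rmorphM /= ea' mulrA -exprS mulrA -exprD subnKC //.
  exact: ltnW (ltn_expl _ p1).
have [|r er] := @unit_of_notin_m (a ^+ (p ^ (e + c.+1)) + x * a').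
  have xa : pi (x * a') = 0 by apply/eqP; rewrite -resk.2; apply: (idealMr _ (ideal_m resk)).
  rewrite resk.2 rmorphD xa addr0 rmorphXn; apply: expf_neq0.
  by rewrite resk.2 in am.
exists (b ^+ (p ^ (e + c.+1)).-1 * to_ic r).
by rewrite mulrA -exprS (prednK (q_gt0 pcharA (e + c.+1))) eb -rmorphM er rmorph1.
Qed.

Lemma socle_list (s : seq B) : (forall j, j \in s -> rad j) ->
  exists y, (~ exists z, y = X * z) /\ forall j, j \in s -> exists z, y * j = X * z.
Proof.
elim: s => [|j s IHs] hs.
  by exists 1; split=> // -[z /esym /eqP]; apply/negP/x_nonunit.
have [|y [ny hy]] := IHs; first by move=> i si; apply: hs; rewrite inE si orbT.
have [e [b' ej]] := hs j (mem_head _ _).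
pose Q n := `[< exists z, y * j ^+ n = X * z >].
have exQ : exists n, Q n by exists (p ^ e)%N; apply/asboolP; exists (y * b'); rewrite ej mulrCA.
case: (ex_minnP exQ) => n /asboolP [z ez] minn.
case: n ez minn => [|n] ez minn; first by case: ny; exists z; rewrite -ez mulr1.
exists (y * j ^+ n); split.
  by move=> h; have := minn n (introT (asboolP _) h); rewrite ltnn.
move=> i; rewrite inE => /orP[/eqP ->|si]; first by exists z; rewrite -mulrA -exprSr.
by have [z' ez'] := hy i si; exists (z' * j ^+ n); rewrite mulrAC ez' mulrA.
Qed.

(** The radical is principal: if [y] is a socle element modulo [x], then
    [y / x] cannot map the radical into itself, since it would be integral. *)
Lemma rad_principal : exists2 t, rad t & forall j, rad j -> exists z, j = t * z.
Proof.
have [c hc] := ic_conductor.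
pose I (a : A) := exists2 j, rad j & to_ic a = X ^+ c * j.
have iI : ideal I.
  split; first by exists 0; [exact: ideal_rad.1 | rewrite rmorph0 mulr0].
  move=> a u v [j rj eu] [j' rj' ev]; exists (to_ic a * j + j'); first exact: ideal_rad.2.
  by rewrite rmorphD rmorphM /= eu ev; ring.
have [n [g [gI gen]]] := noeth_fg noeA iI.
have /choice [j hj] : forall i, exists j, rad j /\ to_ic (g i) = X ^+ c * j.
  by move=> i; have [j rj ej] := gI i; exists j.
have genj (b : B) : rad b -> exists d : 'I_n -> A, b = \sum_i to_ic (d i) * j i.
  move=> rb; have [a ea] := hc b; have [|d ed] := gen a; first by exists b.
  exists d; apply: (mulfI (expf_neq0 c X0)); rewrite -ea ed rmorph_sum mulr_sumr.
  by apply: eq_bigr => i _; rewrite rmorphM /= (hj i).2 mulrCA.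
have [|y [ny hy]] := @socle_list (codom j).
  by move=> _ /codomP [i ->]; exact: (hj i).1.
have /choice [z hz] : forall i, exists z, y * j i = X * z.
  by move=> i; apply: hy; apply: codom_f.
have [i nri] : exists i, ~ rad (z i).
  apply: contrapT => h; apply: ny.
  have /choice [C hC] : forall i, exists d : 'I_n -> A, z i = \sum_l to_ic (d l) * j l.
    by move=> i; apply: genj; apply: contrapT => nr; apply: h; exists i.
  apply: (ic_det_trick X0 (j := j) (C := C)) => [|i]; last by rewrite hz hC.
  apply: contrapT => h0; case/negP: X0; have := rad_x 1; rewrite mulr1 => /genj [d ->].
  rewrite big1 // => i _; have [->|ji] := eqVneq (j i) 0; first by rewrite mulr0.
  by case: h0; exists i.
have [u hu] := rad_or_unit nri.
exists (j i); first exact: (hj i).1.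
move=> b rb; have [d ed] := genj b rb.
have y0 : y != 0 by apply: contra_not_neq ny => ->; exists 0; rewrite mulr0.
exists (\sum_l to_ic (d l) * z l * u); apply: (mulfI y0); apply: (mulfI X0).
rewrite mulrA [y * (_ * _)]mulrA hz -[LHS]mulr1 -hu ed !mulr_sumr mulr_suml.
apply: eq_bigr => l _.
have -> : X * y * (to_ic (d l) * j l) * (z i * u) = X * (y * j l) * to_ic (d l) * (z i * u) by ring.
rewrite hz; ring.
Qed.

(** Take a generator [t] of the radical.  Every nonzero element is a unit times
    a power of [t], whose exponent is a Euclidean function; the [t ^ j] with
    [j < q] generate [B] over its [q]-th powers by Nakayama's lemma. *)
Theorem complete_uniformizer : exists t c, @uniformizer A p m t c.
Proof.
have [t rt ht] := rad_principal; have [c hc] := ic_conductor.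
have [e [b' et]] := rt.
have [tx ex] : exists tx, X = t * tx by apply: ht; have := rad_x 1; rewrite mulr1.
have t0 : t != 0 by apply: contraNneq X0 => t0; rewrite ex t0 mul0r.
have tn n : t ^+ (p ^ e * n) = X ^+ n * b' ^+ n by rewrite exprM et exprMn.
have res b : exists a b1, b = to_ic a + t * b1.
  by have [a /ht [b1 e1]] := ic_residue b; exists a, b1; rewrite -e1 addrC subrK.
have sep b : (forall n, exists z, b = t ^+ n * z) -> b = 0.
  move=> h; apply: ic_separated => n; have [z ->] := h (p ^ e * n)%N.
  by exists (b' ^+ n * z); rewrite tn mulrA.
have nonunit b : t * b != 1.
  by apply/eqP => e1; apply: rad1; rewrite -e1; apply: (idealMr _ ideal_rad).
have mt a : a \in m -> exists b, to_ic a = t * b by move=> /rad_m /ht.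
exists t, (p ^ e * c)%N; split=> //.
- move=> b; have [a ea] := hc (b' ^+ c * b); exists a; by rewrite ea tn mulrA.
- have /choice [d hd] : forall b, exists n, b != 0 -> exists u u', u * u' = 1 /\ b = u * t ^+ n.
    move=> b; have [->|b0] := eqVneq b 0; first by exists 0%N.
    pose Q n := `[< ~ exists z, b = t ^+ n * z >].
    have exQ : exists n, Q n.
      apply: contrapT => h; case/eqP: b0; apply: sep => n; apply: contrapT => h'.
      by apply: h; exists n; apply/asboolP.
    case: (ex_minnP exQ) => n /asboolP nQ minn.
    case: n nQ minn => [|n] nQ minn; first by case: nQ; exists b; rewrite mul1r.
    have [z ez] : exists z, b = t ^+ n * z.
      by apply: contrapT => h; have := minn n (introT (asboolP _) h); rewrite ltnn.
    exists n => _; have [|u hu] := @rad_or_unit z; last by exists z, u; split=> //; rewrite mulrC.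
    by move=> /ht [z' ez']; apply: nQ; exists z'; rewrite exprSr ez ez' mulrA.
  exists d => a b b0; have [->|a0] := eqVneq a 0.
    by exists 0, 0; rewrite mul0r addr0; split=> //; left.
  have [u [u' [uu ea]]] := hd a a0; have [v [v' [vv eb]]] := hd b b0.
  have [le|lt] := leqP (d b) (d a); last by exists 0, a; rewrite mul0r add0r; split=> //; right.
  exists (u * v' * t ^+ (d a - d b)), 0; split; last by left.
  rewrite addr0 {1}ea {2}eb -{1}(subnK le) exprD -[u in LHS]mulr1 -vv; ring.
- move=> e1 b; pose N := frobenius_module pcharB e1 (B^o : lmodType B).
  have approx L : forall b, exists d : 'I_(p ^ e1) -> B, exists b',
      b = \sum_j d j ^+ (p ^ e1) * t ^+ j + t ^+ L * b'.
    elim: L => [|L IHL] b1.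
      exists (fun=> 0), b1; rewrite mul1r big1 ?add0r // => j _.
      by rewrite expr0n (gtn_eqF (q_gt0 pcharA e1)) mul0r.
    have [a [b2 ->]] := res b1; have [a' /mt [s es]] := residue_root pcharA resk closedk e1 a.
    have [d [b3 eb3]] := IHL (s + b2).
    have [|d' ed'] := @frobenius_basis_step A p pcharA e1 t (to_ic a')
      (\sum_j d j ^+ (p ^ e1) * t ^+ j); first by exists d.
    exists d', b3; rewrite -ed'; have -> : to_ic a = to_ic a' ^+ (p ^ e1) + t * s.
      by rewrite -es rmorphB rmorphXn addrC subrK.
    by rewrite -!addrA -mulrDr eb3 mulrDr exprS mulrA.
  apply: (@complete_nakayama B X N _ (fun j : 'I_(p ^ e1) => t ^+ j : B) ic_x_complete).
    move=> y h; apply: ic_separated => n; have [z ez] := h n.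
    exists (X ^+ (n * (p ^ e1).-1) * z : B); rewrite {1}ez.
    have -> : (X ^+ n *: (z : N) : B) = (X ^+ n) ^+ (p ^ e1) * z by [].
    by rewrite mulrA -exprD -exprM -{1}(prednK (q_gt0 pcharA e1)) mulnS.
  move=> y; have [d [y' ey]] := approx (p ^ e * p ^ e1)%N y.
  exists d, (b' ^+ (p ^ e1) * y' : B).
  by rewrite {1}ey tn -mulrA.
Qed.

End WithNonunit.
End CompleteLocal.

(** * The graded case *)

(** The least positive difference of two elements of [S] divides every element
    of [S]: otherwise a remainder would be a smaller difference. *)
Lemma consecutive_degrees (S : nat -> Prop) : S 0%N ->
  (forall i j, S i -> S j -> S (i + j)%N) ->
  (forall d, (forall i, S i -> (d %| i)%N) -> d = 1%N) ->
  exists n, [/\ (0 < n)%N, S n & S n.+1].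
Proof.
move=> S0 SD Sgcd.
have SM w i : S i -> S (w * i)%N by move=> Si; elim: w => // w IHw; rewrite mulSn; apply: SD.
pose D d := `[< (0 < d)%N /\ exists i, S i /\ S (i + d)%N >].
have exD : exists d, D d.
  apply: contrapT => h; suff : 2%N = 1%N by [].
  apply: Sgcd => i Si; case: i Si => // i Si; case: h; exists i.+1.
  by apply/asboolP; split=> //; exists 0%N.
case: (ex_minnP exD) => d /asboolP [d0 [i [Si Sid]]] mind.
have d1 : d = 1%N.
  apply: Sgcd => s Ss; rewrite /dvdn; apply/eqP; apply: contrapT => /eqP r0.
  have /mind : D (s %% d)%N.
    apply/asboolP; rewrite lt0n; split=> //; exists ((s %/ d) * (i + d))%N; split; first exact: SM.
    have -> : ((s %/ d) * (i + d) + s %% d = s + (s %/ d) * i)%N.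
      by rewrite {3}(divn_eq s d); lia.
    by apply: SD => //; apply: SM.
  by rewrite leqNgt ltn_mod d0.
rewrite d1 addn1 in Sid; case: i Si Sid => [|i] Si Sid; last by exists i.+1.
by exists 1%N; split=> //; apply: (SD 1 1)%N.
Qed.

Lemma large_degrees (S : nat -> Prop) n : S 0%N ->
  (forall i j, S i -> S j -> S (i + j)%N) -> (0 < n)%N -> S n -> S n.+1 ->
  forall j, (n * n <= j)%N -> S j.
Proof.
move=> S0 SD n0 Sn Sn1 j nj.
have SM w i : S i -> S (w * i)%N by move=> Si; elim: w => // w IHw; rewrite mulSn; apply: SD.
have -> : j = ((j %/ n - j %% n) * n + (j %% n) * n.+1)%N.
  have lr : (j %% n < n)%N by rewrite ltn_mod.
  have lw : (n <= j %/ n)%N by rewrite leq_divRL.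
  rewrite {1}(divn_eq j n) mulnBl mulnS.
  have : ((j %% n) * n <= (j %/ n) * n)%N by rewrite leq_mul2r; apply/orP; right; lia.
  lia.
by apply: SD; apply: SM.
Qed.

Section GradingProjections.
Variables (I : choiceType) (V : zmodType) (H : I -> {pred V}).
Hypothesis gH : is_grading H.

Let Hzero i : 0 \in H i. Proof. by have [h _ _] := gH; exact: (h i).1. Qed.
Let Hsub i x y : x \in H i -> y \in H i -> x - y \in H i.
Proof. by have [h _ _] := gH; exact: (h i).2. Qed.
Let Hadd i x y : x \in H i -> y \in H i -> x + y \in H i.
Proof. by move=> xH yH; rewrite -[y]opprK; apply: Hsub => //; rewrite -sub0r; apply: Hsub. Qed.

Lemma sum_support (s r : seq I) (f : I -> V) : uniq s -> uniq r -> {subset s <= r} ->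
  (forall i, i \notin s -> f i = 0) -> \sum_(i <- r) f i = \sum_(i <- s) f i.
Proof.
move=> us ur sr f0; rewrite (bigID (mem s)) /= [X in _ + X]big1 ?addr0; last first.
  by move=> i /f0.
rewrite -big_filter; apply: perm_big; apply: uniq_perm => //; first exact: filter_uniq.
by move=> i; rewrite mem_filter /=; case: (boolP (i \in s)) => //= /sr ->.
Qed.

Lemma grading_projections : exists pr : I -> V -> V,
  [/\ forall i x y, pr i (x - y) = pr i x - pr i y,
      forall i x, pr i x \in H i,
      forall i j x, x \in H i -> pr j x = if j == i then x else 0 &
      forall x, exists s, uniq s /\ forall i, i \notin s -> pr i x = 0] /\
  forall x s, uniq s -> (forall i, i \notin s -> pr i x = 0) -> x = \sum_(i <- s) pr i x.
Proof.
have [_ dec uni] := gH.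
pose D (x : V) (f : I -> V) := (forall i, f i \in H i) /\
  exists s, [/\ uniq s, forall i, i \notin s -> f i = 0 & x = \sum_(i <- s) f i].
have exD x : exists f, D x f.
  have [s [f [fH ex]]] := dec x; exists (fun i => \sum_(j <- s | j == i) f j); split.
    move=> i; apply: (big_ind (fun z => z \in H i)) => [//|u v uH vH|j /eqP <- //].
    exact: Hadd.
  exists (undup s); rewrite undup_uniq; split=> // [i|].
    rewrite mem_undup => /negP si; rewrite big_seq_cond big1 // => j /andP[js /eqP ji].
    by case: si; rewrite -ji.
  rewrite ex (exchange_big_dep xpredT) //= big_seq [RHS]big_seq; apply: eq_bigr => j js.
  under eq_bigl => i do rewrite eq_sym.
  by rewrite -big_filter (@filter_pred1_uniq _ _ j) ?undup_uniq ?mem_undup // big_seq1.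
have DB x y f g : D x f -> D y g -> D (x - y) (fun i => f i - g i).
  move=> [fH [s [us f0 ->]]] [gH' [r [ur g0 ->]]]; split; first by move=> i; apply: Hsub.
  exists (undup (s ++ r)); rewrite undup_uniq; split=> // [i|].
    by rewrite mem_undup mem_cat negb_or => /andP[/f0 -> /g0 ->]; rewrite subrr.
  rewrite sumrB; congr (_ - _); apply/esym/sum_support; rewrite ?undup_uniq //.
    by move=> i h; rewrite mem_undup mem_cat h.
  by move=> i h; rewrite mem_undup mem_cat h orbT.
have D0 f : D 0 f -> forall i, f i = 0.
  move=> [fH [s [us f0 /esym e]]] i; have [si|/f0 //] := boolP (i \in s).
  exact: (uni s f us fH e).
have Duniq x f g : D x f -> D x g -> f =1 g.
  move=> Df Dg i; have := DB _ _ _ _ Df Dg; rewrite subrr => /D0/(_ i)/eqP.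
  by rewrite subr_eq0 => /eqP.
have [F hF] := choice exD; exists (fun i x => F x i); split; first split.
- move=> i x y; apply: (Duniq (x - y) _ (fun i => F x i - F y i)) => //.
  exact: DB.
- by move=> i x; exact: (hF x).1.
- move=> i j x xH; apply: (Duniq x _ (fun j => if j == i then x else 0)) => //; split=> //.
    by move=> l; case: eqP => [->|_].
  exists [:: i]; split=> // [l|]; first by rewrite inE => /negPf ->.
  by rewrite big_seq1 eqxx.
- by move=> x; have [_ [s [us f0 _]]] := hF x; exists s.
move=> x s us s0; have [_ [r [ur r0 ex]]] := hF x; rewrite {1}ex.
have e1 := @sum_support r (undup (s ++ r)) (F x) ur (undup_uniq _) _ r0.
have e2 := @sum_support s (undup (s ++ r)) (F x) us (undup_uniq _) _ s0.
rewrite -e1 -?e2 // => i h; by rewrite mem_undup mem_cat h ?orbT.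
Qed.

End GradingProjections.

Section GradedRing.
Variables (A : idomainType) (G : nat -> {pred A}).
Hypothesis gradG : graded_ring G.

Let Gsub i x y : x \in G i -> y \in G i -> x - y \in G i.
Proof. by have [[h _ _] _ _ _] := gradG; exact: (h i).2. Qed.
Let Gzero i : 0 \in G i.
Proof. by have [[h _ _] _ _ _] := gradG; exact: (h i).1. Qed.
Let Gadd i x y : x \in G i -> y \in G i -> x + y \in G i.
Proof. by move=> xG yG; rewrite -[y]opprK; apply: Gsub => //; rewrite -sub0r; apply: Gsub. Qed.

Lemma graded1 : 1 \in G 0%N. Proof. by have [_ h _ _] := gradG. Qed.
Lemma gradedM i j x y : x \in G i -> y \in G j -> x * y \in G (i + j)%N.
Proof. by have [_ _ h _] := gradG; exact: h. Qed.
Lemma gradedX i x n : x \in G i -> x ^+ n \in G (n * i)%N.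
Proof.
move=> xG; elim: n => [|n IHn]; first exact: graded1.
by rewrite exprS mulSn; apply: gradedM.
Qed.
Lemma graded_sum i (T : Type) (s : seq T) (P : pred T) (F : T -> A) :
  (forall j, P j -> F j \in G i) -> \sum_(j <- s | P j) F j \in G i.
Proof.
by move=> h; apply: (big_ind (fun z => z \in G i)) => // u v; apply: Gadd.
Qed.

(** The coaction [x |-> \sum_i x_i X^i] records all homogeneous components of
    [x] in one ring homomorphism. *)
Lemma graded_coaction : exists gamma : {rmorphism A -> {poly A}},
  [/\ forall x i, (gamma x)`_i \in G i, forall x, (gamma x).[1] = x &
      forall i x, x \in G i -> gamma x = x *: 'X^i].
Proof.
have [[_ dec uni] _ _ _] := gradG.
pose D x (P : {poly A}) := (forall i, P`_i \in G i) /\ P.[1] = x.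
have exD x : exists P, D x P.
  have [s [f [fG ->]]] := dec x; exists (\sum_(i <- s) f i *: 'X^i); split=> [i|].
    rewrite coef_sum; apply: graded_sum => j _; rewrite coefZ coefXn.
    by case: eqP => [->|_]; rewrite ?mulr1 ?mulr0.
  by rewrite horner_sum; apply: eq_bigr => i _; rewrite hornerZ hornerXn expr1n mulr1.
have D0 P : D 0 P -> P = 0.
  move=> [PG]; rewrite horner_coef => e; apply/polyP => i; rewrite coef0.
  have [ilt|] := ltnP i (size P); last exact: nth_default.
  apply: (uni (iota 0 (size P)) (fun i => P`_i)); rewrite ?iota_uniq ?mem_iota //.
  rewrite -[RHS]e -(big_mkord xpredT (fun i => P`_i * 1 ^+ i)) /index_iota subn0.
  by apply: eq_bigr => j _; rewrite expr1n mulr1.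
have DB x y P Q : D x P -> D y Q -> D (x - y) (P - Q).
  move=> [PG <-] [QG <-]; split=> [i|]; first by rewrite coefB; apply: Gsub.
  by rewrite !hornerE.
have Duniq x P Q : D x P -> D x Q -> P = Q.
  move=> DP DQ; have := DB _ _ _ _ DP DQ; rewrite subrr => /D0 /eqP.
  by rewrite subr_eq0 => /eqP.
have [f hf] := choice exD.
have Dh i x : x \in G i -> D x (x *: 'X^i).
  move=> xG; split=> [j|]; last by rewrite hornerZ hornerXn expr1n mulr1.
  by rewrite coefZ coefXn; case: eqP => [->|_]; rewrite ?mulr1 ?mulr0.
have zf : zmod_morphism f by move=> x y; apply: (Duniq (x - y)) => //; apply: DB.
have mf : monoid_morphism f.
  split=> [|x y].
    by apply: (Duniq 1) => //; rewrite -[X in D _ X]scale1r; apply: (Dh 0%N); exact: graded1.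
  apply: (Duniq (x * y)) => //; split=> [i|]; last by rewrite hornerM (hf x).2 (hf y).2.
  rewrite coefM; apply: graded_sum => j _.
  by have := gradedM ((hf x).1 j) ((hf y).1 (i - j)%N); rewrite subnKC // -ltnS.
pose gamma : {rmorphism A -> {poly A}} := HB.pack f
  (GRing.isZmodMorphism.Build _ _ f zf) (GRing.isMonoidMorphism.Build _ _ f mf).
exists gamma; split=> [x i|x|i x xG].
- exact: (hf x).1.
- exact: (hf x).2.
exact: (Duniq x _ _ (hf x) (Dh _ _ xG)).
Qed.

Variables (m : {pred A}) (k : fieldType) (pi : {rmorphism A -> k}).
Local Notation B := (integral_closure A).
Hypotheses (noeA : noetherian A) (dim1 : krull_dim A 1).
Hypothesis irr_m : m =i irrelevant_ideal G.
Hypotheses (resk : residue_field m pi) (closedk : GRing.closed_field_axiom k).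

Section WithCoaction.
Variable gamma : {rmorphism A -> {poly A}}.
Hypotheses (gammaG : forall x i, (gamma x)`_i \in G i) (gamma1 : forall x, (gamma x).[1] = x).
Hypothesis gammaH : forall i x, x \in G i -> gamma x = x *: 'X^i.

Lemma comp_homog i j x : x \in G i -> (gamma x)`_j = if j == i then x else 0.
Proof. by move=> /gammaH ->; rewrite coefZ coefXn; case: eqP; rewrite ?mulr1 ?mulr0. Qed.

Lemma sum_comp x : x = \sum_(i < size (gamma x)) (gamma x)`_i.
Proof.
rewrite -[LHS]gamma1 horner_coef; apply: eq_bigr => i _.
by rewrite expr1n mulr1.
Qed.

Lemma comp_mul_homog i n x y : x \in G i -> (i <= n)%N ->
  (gamma (x * y))`_n = x * (gamma y)`_(n - i).
Proof.
move=> /gammaH e le; rewrite rmorphM /= e -scalerAl coefZ coefXnM.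
by rewrite ltnNge le.
Qed.

Lemma in_mE x : (x \in m) = ((gamma x)`_0 == 0).
Proof.
rewrite irr_m; apply/asboolP/eqP => [[s [f [s0 fG ->]]]|x0].
  rewrite rmorph_sum coef_sum big_seq big1 // => i /s0 i0.
  by rewrite (comp_homog _ (fG i)) eq_sym (gtn_eqF i0).
exists (filter (fun i => 0 < i)%N (iota 0 (size (gamma x)))), (fun i => (gamma x)`_i).
split=> // [i|]; first by rewrite mem_filter => /andP[].
rewrite big_filter [LHS]sum_comp -(big_mkord xpredT (fun i => (gamma x)`_i)).
rewrite /index_iota subn0 [LHS](bigID (fun i => 0 < i)%N) /= [X in _ + X]big1 ?addr0 //.
by move=> i; rewrite -eqn0Ngt => /eqP ->.
Qed.

Lemma degree0_inj x : x \in G 0%N -> pi x = 0 -> x = 0.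
Proof.
move=> xG /eqP; rewrite -resk.2 in_mE (comp_homog _ xG) eqxx; exact: eqP.
Qed.

Lemma degree0_rep x : exists2 a, a \in G 0%N & x - a \in m.
Proof.
exists (gamma x)`_0; first exact: gammaG.
by rewrite in_mE rmorphB coefB (comp_homog _ (gammaG x 0%N)) eqxx subrr.
Qed.

Lemma residue_section : exists sigma : {rmorphism k -> A},
  (forall c, sigma c \in G 0%N) /\ (forall c, pi (sigma c) = c).
Proof.
have /choice [f hf] : forall c, exists a, a \in G 0%N /\ pi a = c.
  move=> c; have [x <-] := resk.1 c; have [a aG am] := degree0_rep x.
  exists a; split=> //; move: am; rewrite resk.2 rmorphB subr_eq0.
  by move/eqP.
have eqf a b : a \in G 0%N -> b \in G 0%N -> pi a = pi b -> a = b.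
  move=> aG bG e; apply/eqP; rewrite -subr_eq0; apply/eqP; apply: degree0_inj.
    exact: Gsub.
  by rewrite rmorphB e subrr.
have fG c : f c \in G 0%N by exact: (hf c).1.
have fpi c : pi (f c) = c by exact: (hf c).2.
have zf : zmod_morphism f.
  by move=> x y; apply: eqf => //; [exact: Gsub | rewrite rmorphB /= !fpi].
have mf : monoid_morphism f.
  split=> [|x y]; apply: eqf => //; rewrite ?fpi ?rmorph1 //; first exact: graded1.
    exact: (gradedM (fG x) (fG y)).
  by rewrite rmorphM /= !fpi.
pose sigma : {rmorphism k -> A} := HB.pack f
  (GRing.isZmodMorphism.Build _ _ f zf) (GRing.isMonoidMorphism.Build _ _ f mf).
by exists sigma.
Qed.

(** A prime containing a homogeneous element [a] contains the prime of all
    elements whose components lie in it, which is nonzero and inside [m]. *)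
Lemma graded_pow_in d a : a \in G d -> a != 0 ->
  exists N, pow_in m N (fun x => exists y, x = a * y).
Proof.
move=> aG a0; apply: pow_in_of_primes => // P iP P1 pP Pa x xm.
pose Ps x := forall i, P (gamma x)`_i.
have iPs : ideal Ps.
  split; first by move=> i; rewrite rmorph0 coef0; exact: iP.1.
  move=> b y z Py Pz i; rewrite rmorphD rmorphM coefD; apply: (idealD iP) => //.
  by rewrite coefM; apply: (ideal_sum _ iP) => j _; apply: (idealM _ iP).
have Ps1 : ~ Ps 1 by move=> /(_ 0%N); rewrite rmorph1 coef1.
have exmin y : ~ Ps y -> exists i, ~ P (gamma y)`_i /\ forall j, (j < i)%N -> P (gamma y)`_j.
  move=> h; pose Q i := `[< ~ P (gamma y)`_i >].
  have exQ : exists i, Q i.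
    by apply: contrapT => h'; apply: h => i; apply: contrapT => nP; apply: h'; exists i; apply/asboolP.
  case: (ex_minnP exQ) => i /asboolP nP mini; exists i; split=> // j ji.
  by apply: contrapT => nPj; have := mini j (introT (asboolP _) nPj); rewrite leqNgt ji.
suff : Ps x by rewrite [X in _ -> P X]sum_comp => h; apply: (ideal_sum _ iP) => i _; apply: h.
move: x xm; apply: (dim_one_prime dim1 resk iPs Ps1).
- move=> y z Pyz; apply: contrapT => h.
  have [i [nPi mini]] : exists i, ~ P (gamma y)`_i /\ forall j, (j < i)%N -> P (gamma y)`_j.
    by apply: exmin => Py; apply: h; left.
  have [j [nPj minj]] : exists i, ~ P (gamma z)`_i /\ forall j, (j < i)%N -> P (gamma z)`_j.
    by apply: exmin => Pz; apply: h; right.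
  have il : (i < (i + j).+1)%N by rewrite ltnS leq_addr.
  have := Pyz (i + j)%N; rewrite rmorphM coefM (bigD1 (Ordinal il)) //= addKn => Ps0.
  have : P ((gamma y)`_i * (gamma z)`_j).
    rewrite -[X in P X](addrK (\sum_(l < (i + j).+1 | l != Ordinal il)
       (gamma y)`_l * (gamma z)`_(i + j - l))); apply: (idealB iP) => //.
    apply: (ideal_sum _ iP) => l ll.
    have [li|il'] := ltnP l i; first by apply: (idealMr _ iP); apply: mini.
    apply: (idealM _ iP); apply: minj; have : i != l by rewrite eq_sym.
    by move: (ltn_ord l) => /=; lia.
  by case/pP.
- exists a => // i; rewrite (comp_homog _ aG); case: eqP => // _; exact: iP.1.
- move=> y Py; rewrite in_mE; apply: contrapT => /negP y0; apply: P1.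
  have : (gamma y)`_0 \notin m.
    rewrite in_mE (comp_homog _ (gammaG y 0%N)) eqxx //.
  move=> /(residue_inv resk) [b bm].
  suff -> : 1 = (gamma y)`_0 * (gamma b)`_0 by apply: (idealMr _ iP); exact: Py.
  apply/eqP; rewrite -subr_eq0; move: bm; rewrite in_mE rmorphB rmorph1 coefB coef1 /=.
  by rewrite (comp_mul_homog _ (gammaG y 0%N) (leqnn 0)).
Qed.

Lemma m_gen : exists n (g : 'I_n -> A), (forall i, g i \in m) /\
  forall x, x \in m -> exists c : 'I_n -> A, x = \sum_i c i * g i.
Proof. exact: (noeth_fg noeA (ideal_m resk)). Qed.

(** [A / f A] is spanned over [k] by finitely many elements, so its components
    of large degree vanish. *)
Lemma mul_homog_surj d f : (0 < d)%N -> f \in G d -> f != 0 -> exists n0, forall n x,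
  (n0 <= n)%N -> x \in G (n + d)%N -> exists2 y, y \in G n & x = f * y.
Proof.
move=> d0 fG f0; have [N hN] := graded_pow_in fG f0.
have [s [g [gm gen]]] := m_gen.
have [T [v hv]] := span_mod_pow gm gen degree0_rep N.
exists (\max_t size (gamma (v t))) => n x n0 xG.
have [a [aG /(_ _ (principal_ideal f) hN) [y ey]]] := hv x.
exists (gamma y)`_n => //.
have := congr1 (fun z => (gamma z)`_(n + d)) ey.
rewrite (comp_mul_homog _ fG) ?leq_addl // addnK => <-.
rewrite rmorphB coefB (comp_homog _ xG) eqxx rmorph_sum coef_sum big1 ?subr0 // => t _.
rewrite (comp_mul_homog _ (aG t)) // subn0 nth_default ?mulr0 //.
apply: leq_trans (leq_addr _ _); apply: leq_trans n0; exact: leq_bigmax.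
Qed.

Variable sigma : {rmorphism k -> A}.
Hypotheses (sigmaG : forall c, sigma c \in G 0%N) (sigmaK : forall c, pi (sigma c) = c).

Lemma degree0E x : x \in G 0%N -> x = sigma (pi x).
Proof.
move=> xG; apply/eqP; rewrite -subr_eq0; apply/eqP; apply: degree0_inj.
  exact: Gsub.
by rewrite rmorphB sigmaK subrr.
Qed.

(** The elements of degree at least [n] form a finitely generated ideal; the
    degree [n] components of its generators span the component. *)
Lemma component_finite n : exists s (w : 'I_s -> A), (forall i, w i \in G n) /\
  forall x, x \in G n -> exists c : 'I_s -> k, x = \sum_i sigma (c i) * w i.
Proof.
pose I x := forall i, (i < n)%N -> (gamma x)`_i = 0.
have iI : ideal I.
  split; first by move=> i _; rewrite rmorph0 coef0.
  move=> a x y Ix Iy i ilt; rewrite rmorphD rmorphM coefD Iy // addr0 coefM big1 // => j _.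
  by rewrite Ix ?mulr0 //; apply: leq_ltn_trans ilt; rewrite leq_subr.
have [s [g [gI gen]]] := noeth_fg noeA iI.
exists s, (fun i => (gamma (g i))`_n); split=> // x xG.
have [|c ec] := gen x.
  by move=> i ilt; rewrite (comp_homog _ xG) (ltn_eqF ilt).
exists (fun i => pi (gamma (c i))`_0).
have := congr1 (fun z => (gamma z)`_n) ec; rewrite (comp_homog _ xG) eqxx => ->.
rewrite rmorph_sum coef_sum; apply: eq_bigr => i _.
rewrite -degree0E // rmorphM coefM big_ord_recl /= subn0 [X in _ + X]big1 ?addr0 // => j _.
by rewrite gI ?mulr0 //= /bump leq0n; have := ltn_ord j; lia.
Qed.

(** Multiplication by [g / f] maps a component of large degree into itself.
    This component is finite-dimensional, so [g / f] is a root of a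
    characteristic polynomial, which splits over [k]. *)
Lemma component_dim1 d f g : (0 < d)%N -> f \in G d -> g \in G d -> f != 0 ->
  exists c, g = sigma c * f.
Proof.
move=> d0 fG gG f0; have [n0 surj] := mul_homog_surj d0 fG f0.
pose n := (n0 * d)%N; have n0n : (n0 <= n)%N by rewrite leq_pmulr.
have [s [w [wG gen]]] := component_finite n.
have fn : f ^+ n0 \in G n by exact: gradedX.
have /choice [C hC] : forall i, exists c : 'I_s -> k, g * w i = f * \sum_l sigma (c l) * w l.
  move=> i; have [|y yG ->] := surj n (g * w i) n0n; first by rewrite addnC; apply: gradedM.
  by have [c ->] := gen y yG; exists c.
pose fr := @FracField.tofrac A; pose rho := fr \o sigma.
have fr0 x : x != 0 -> fr x != 0 by rewrite tofrac_eq0.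
pose M : 'M[k]_s := \matrix_(u, v) C v u.
pose z := fr g / fr f.
have : root (map_poly rho (char_poly M)) z.
  rewrite map_char_poly -eigenvalue_root_char.
  apply/eigenvalueP; exists (\row_i fr (w i)).
    apply/rowP => i; rewrite !mxE -mulrAC; apply: (canRL (mulfK (fr0 _ f0))).
    rewrite -rmorphM hC rmorphM mulrC; congr (_ * _); rewrite rmorph_sum.
    by apply: eq_bigr => l _; rewrite !mxE rmorphM mulrC.
  apply: contraTneq f0 => /rowP w0; rewrite negbK.
  have [c ec] := gen _ fn; suff : f ^+ n0 == 0 by rewrite expf_eq0 => /andP[].
  rewrite ec big1 // => i _; have /eqP := w0 i; rewrite !mxE tofrac_eq0 => /eqP ->.
  by rewrite mulr0.
have [r er] := closed_field_split closedk (char_poly_monic M).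
rewrite er rmorph_prod /root horner_prod prodf_seq_eq0 => /hasP [c _ /=].
rewrite rmorphB /= map_polyX map_polyC hornerXsubC subr_eq0 => /eqP ez.
exists c; apply/eqP; rewrite -tofrac_eq; apply/eqP; rewrite rmorphM.
have -> : FracField.tofrac g = z * fr f by rewrite divfK // fr0.
by rewrite ez.
Qed.

Lemma sigma_eq0 c : (sigma c == 0) = (c == 0).
Proof. exact: fmorph_eq0. Qed.

Variables (p : nat) (pcharA : p \in [pchar A]).

Section MonomialBasis.
Variables (n : nat) (a b : A).
Hypotheses (n0 : (0 < n)%N) (aG : a \in G n) (bG : b \in G n.+1).
Hypotheses (a0 : a != 0) (b0 : b != 0).
Variable t : B.
Hypothesis et : to_ic a * t = to_ic b.

Let ia0 : to_ic a != 0. Proof. by rewrite to_ic_eq0. Qed.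
Let ib0 : to_ic b != 0. Proof. by rewrite to_ic_eq0. Qed.
Let t0 : t != 0.
Proof. by apply: contraNneq ib0 => e; rewrite -et e mulr0. Qed.

(** Both [x * a ^ i] and [b ^ i] have degree [i * (n + 1)], so they are
    proportional, and [t = b / a]. *)
Lemma homog_monomial i x : x \in G i -> exists c, to_ic x = to_ic (sigma c) * t ^+ i.
Proof.
case: i => [|i] xG; first by exists (pi x); rewrite -degree0E // mulr1.
have [||||c ec] := @component_dim1 (i.+1 * n.+1)%N (b ^+ i.+1) (x * a ^+ i.+1).
- by rewrite muln_gt0.
- exact: gradedX.
- by rewrite mulnS; apply: gradedM => //; apply: gradedX.
- exact: expf_neq0.
exists c; apply: (mulIf (expf_neq0 i.+1 ia0)).
have -> : to_ic x * to_ic a ^+ i.+1 = to_ic (sigma c) * to_ic b ^+ i.+1.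
  by rewrite -!rmorphXn -!rmorphM ec.
by rewrite -mulrA [t ^+ _ * _]mulrC -exprMn et.
Qed.

Lemma monomial_in i : (n * n <= i)%N -> exists x, to_ic x = t ^+ i.
Proof.
move=> ni; have [x [xG x0]] : exists x, x \in G i /\ x != 0.
  apply: (@large_degrees (fun i => exists x, x \in G i /\ x != 0) n) => //.
  - by exists 1; split; [exact: graded1 | exact: oner_neq0].
  - move=> u v [x [xG x0]] [y [yG y0]]; exists (x * y); split; first exact: gradedM.
    exact: mulf_neq0.
  - by exists a.
  - by exists b.
have [c ec] := homog_monomial xG.
have c0 : c != 0.
  apply: contraNneq x0 => c0; rewrite -to_ic_eq0 ec c0 !rmorph0 mul0r //.
exists (sigma c^-1 * x); rewrite rmorphM /= ec mulrA -!rmorphM mulVf //.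
by rewrite !rmorph1 mul1r.
Qed.

(** The evaluation [k[X] -> B] at [t], which turns out to be an isomorphism. *)
Definition psi (P : {poly k}) : B := (map_poly (to_ic \o sigma) P).[t].

Lemma psiE P : psi P = \sum_(i < size P) to_ic (sigma P`_i) * t ^+ i.
Proof.
rewrite /psi horner_coef size_map_inj_poly ?rmorph0 //; last exact: fmorph_inj.
by apply: eq_bigr => i _; rewrite coef_map.
Qed.
Fact psi_zmod : zmod_morphism psi.
Proof. by move=> P Q; rewrite /psi rmorphB hornerD hornerN. Qed.
Fact psi_monoid : monoid_morphism psi.
Proof.
split=> [|P Q]; first by rewrite /psi rmorph1 hornerC.
by rewrite /psi rmorphM hornerM.
Qed.
HB.instance Definition _ := GRing.isZmodMorphism.Build {poly k} B psi psi_zmod.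
HB.instance Definition _ := GRing.isMonoidMorphism.Build {poly k} B psi psi_monoid.
Lemma psiX : psi 'X = t. Proof. by rewrite /psi map_polyX hornerX. Qed.
Lemma psiC c : psi c%:P = to_ic (sigma c). Proof. by rewrite /psi map_polyC hornerC. Qed.

(** Clearing denominators in [P(b / a) = 0] gives terms of distinct degrees. *)
Lemma psi_eq0 P : psi P = 0 -> P = 0.
Proof.
move=> e; apply/polyP => i; rewrite coef0.
have [ilt|] := ltnP i (size P); last exact: nth_default.
pose N := size P.
have : \sum_(j < N) sigma P`_j * (a ^+ (N - j) * b ^+ j) = 0.
  apply: to_ic_inj; rewrite rmorph0.
  transitivity (to_ic a ^+ N * psi P); last by rewrite e mulr0.
  rewrite rmorph_sum psiE mulr_sumr; apply: eq_bigr => j _.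
  rewrite !rmorphM !rmorphXn /= -et [RHS]mulrCA; congr (_ * _).
  by rewrite exprMn mulrA -exprD subnK // ltnW.
move/(congr1 (fun z => (gamma z)`_(n * N + i))).
rewrite rmorph0 coef0 rmorph_sum coef_sum /=.
have hom (j : 'I_N) : sigma P`_j * (a ^+ (N - j) * b ^+ j) \in G (n * N + j)%N.
  have -> : (n * N + j = 0 + ((N - j) * n + j * n.+1))%N.
    have : (j <= N)%N by apply: ltnW.
    by move=> /subnK {1}<-; rewrite mulnDr mulnS mulnC; lia.
  by apply: gradedM => //; apply: gradedM; apply: gradedX.
rewrite (bigD1 (Ordinal ilt)) //= big1 ?addr0 => [|j ji].
  rewrite (comp_homog _ (hom (Ordinal ilt))) /= eqxx => /eqP.
  rewrite mulf_eq0 sigma_eq0 => /orP[/eqP //|]; apply: contraTeq => _.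
  by apply: mulf_neq0; apply: expf_neq0.
rewrite (comp_homog _ (hom j)) eqn_add2l; case: eqP => // e1.
by case/eqP: ji; apply: val_inj.
Qed.

Lemma psi_inj : injective psi.
Proof. by move=> P Q e; apply/eqP; rewrite -subr_eq0; apply/eqP/psi_eq0; rewrite rmorphB /= e subrr. Qed.

Lemma to_ic_psi x : exists P, to_ic x = psi P /\ sigma P`_0 = (gamma x)`_0.
Proof.
have [c hc] := choice (fun i => homog_monomial (gammaG x i)).
exists (\poly_(i < size (gamma x)) c i); split.
  rewrite [in LHS](sum_comp x) rmorph_sum poly_def rmorph_sum; apply: eq_bigr => i _ /=.
  by rewrite hc -mul_polyC rmorphM rmorphXn /= psiX psiC.
rewrite coef_poly; case: ltnP => h; last by rewrite rmorph0 nth_default.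
by apply: to_ic_inj; rewrite hc mulr1.
Qed.

(** [k[t]] is integrally closed: a root of a monic polynomial, written as a
    reduced fraction, has a constant denominator. *)
Lemma psi_surj (x : B) : exists P, x = psi P.
Proof.
have [w [w' [w0 ew]]] := ic_denom x.
have [U [eU _]] := to_ic_psi w; have [V [eV _]] := to_ic_psi w'.
have U0 : U != 0 by apply: contraNneq w0 => e; rewrite -to_ic_eq0 eU e rmorph0.
pose g := gcdp U V.
have g0 : g != 0 by rewrite gcdp_eq0 negb_and U0.
pose U1 := U %/ g; pose V1 := V %/ g.
have eU1 : U = U1 * g by rewrite divpK // dvdp_gcdl.
have eV1 : V = V1 * g by rewrite divpK // dvdp_gcdr.
have cop : coprimep U1 V1 by apply: coprimep_div_gcd; rewrite U0.
have ex : psi U1 * x = psi V1.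
  have pg0 : psi g != 0 by apply: contraNneq g0 => /psi_eq0 ->.
  apply: (mulIf pg0); rewrite mulrAC -!rmorphM /= -eU1 -eV1 -eU ew eV //.
have [F [mF Fx]] := ic_monic x.
have sF : size (map_poly to_ic F) = (size F).-1.+1.
  rewrite size_map_poly_id0; last by rewrite (monicP mF) rmorph1 oner_neq0.
  by rewrite prednK // size_poly_gt0 monic_neq0.
set N := (size F).-1 in sF.
have [Fc hFc] := choice to_ic_psi.
have e : psi (V1 ^+ N) = psi (U1 * - \sum_(i < N) Fc F`_i * V1 ^+ i * U1 ^+ (N - i.+1)).
  have := congr1 (fun y => psi U1 ^+ N * y) Fx.
  rewrite mulr0 horner_coef sF big_ord_recr /= coef_map /=.
  have -> : F`_N = 1 by exact/eqP.
  rewrite rmorph1 mul1r mulrDr -exprMn ex addrC => /eqP.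
  rewrite addr_eq0 [X in _ -> X = _]rmorphXn /= => /eqP ->.
  rewrite mulrN rmorphN; congr (- _).
  rewrite !mulr_sumr rmorph_sum; apply: eq_bigr => i _.
  have -> : psi U1 ^+ N = psi U1 * psi U1 ^+ i * psi U1 ^+ (N - i.+1).
    by rewrite -exprS -exprD subnKC.
  rewrite coef_map /= (hFc _).1 !rmorphM !rmorphXn /= -ex exprMn; ring.
have {e}dv : U1 %| V1 ^+ N.
  by rewrite (psi_inj e) dvdp_mulIl.
have sU : size U1 == 1%N.
  by rewrite size_poly_eq1; move/coprimepP: (coprimep_expr N cop); apply; rewrite ?dvdpp.
have [c c0 eU1c] := size_poly1P _ sU.
exists ((c^-1)%:P * V1).
rewrite rmorphM /= -ex eU1c !psiC mulrA -!rmorphM mulVf // !rmorph1 mul1r //.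
Qed.

Lemma graded_uniformizer : uniformizer p m t (n * n).
Proof.
have [inv hinv] := choice psi_surj.
have conv x : psi (inv x) = x by rewrite -hinv.
split.
- exact: t0.
- move=> x; rewrite -[x]conv -psiX -rmorphM -(rmorph1 psi) (inj_eq psi_inj).
  apply/eqP => /(congr1 (fun P : {poly k} => P`_0)); rewrite coefXM coef1 /=.
  by move/eqP; rewrite eq_sym oner_eq0.
- move=> x; have [M hM] := choice (fun i => @monomial_in (n * n + i)%N (leq_addr _ _)).
  exists (\sum_(i < size (inv x)) sigma (inv x)`_i * M i).
  transitivity (t ^+ (n * n) * psi (inv x)); last by rewrite conv.
  rewrite rmorph_sum psiE mulr_sumr; apply: eq_bigr => i _.
  by rewrite rmorphM /= hM exprD mulrCA.
- move=> x; elim/poly_ind: (inv x) (conv x) => [|P c _] e.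
    by exists 0, 0; rewrite -e !rmorph0 mulr0 addr0.
  exists (sigma c), (psi P).
  by rewrite -e rmorphD rmorphM /= psiX psiC addrC mulrC.
- move=> x; rewrite in_mE => /eqP x0; have [P [eP]] := to_ic_psi x.
  rewrite x0 => /eqP; rewrite sigma_eq0.
  elim/poly_ind: P eP => [|P c _] eP; first by exists 0; rewrite eP rmorph0 mulr0.
  rewrite coefD coefMX coefC eqxx add0r => /eqP c0; exists (psi P).
  by rewrite eP c0 addr0 rmorphM /= psiX mulrC.
- exists (fun x => size (inv x)) => x y y0.
  have iy0 : inv y != 0 by apply: contraNneq y0 => e; rewrite -[y]conv e rmorph0.
  exists (psi (inv x %/ inv y)), (psi (inv x %% inv y)); split.
    by have := congr1 psi (divp_eq (inv x) (inv y)); rewrite rmorphD rmorphM /= !conv.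
  right; have -> : inv (psi (inv x %% inv y)) = inv x %% inv y by apply: psi_inj; rewrite conv.
  by rewrite ltn_modp.
- move=> x h; have [z ez] := h (size (inv x)).
  have e : inv x = 'X^(size (inv x)) * inv z.
    by apply: psi_inj; rewrite conv rmorphM rmorphXn /= psiX conv.
  have [iz0|iz0] := eqVneq (inv z) 0; first by rewrite -[x]conv e iz0 mulr0 rmorph0.
  have /eqP : size (inv x) = (size (inv x) + size (inv z))%N.
    by rewrite {1}e mulrC size_mulXn.
  by rewrite -{1}[size (inv x)]addn0 eqn_add2l eq_sym size_poly_eq0 (negPf iz0).
- move=> e x; rewrite -[x]conv; elim/poly_ind: (inv x) => [|P c IH].
    exists (fun=> 0); rewrite rmorph0 big1 // => j _.
    by rewrite expr0n (gtn_eqF (q_gt0 pcharA e)) mul0r.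
  have [c' hc'] := closedk (fun i => if i == 0%N then c else 0) (q_gt0 pcharA e).
  have ec : c = c' ^+ (p ^ e).
    rewrite hc' -(prednK (q_gt0 pcharA e)) big_ord_recl /= mulr1 big1 ?addr0 //.
    by move=> i _; rewrite mul0r.
  have [d ed] := @frobenius_basis_step A p pcharA e t (to_ic (sigma c')) (psi P) IH.
  exists d; rewrite -ed rmorphD rmorphM /= psiX psiC ec !rmorphXn addrC.
  by rewrite mulrC.
Qed.

End MonomialBasis.

Lemma graded_uniformizer_exists : exists t c, @uniformizer A p m t c.
Proof.
have [_ _ _ gcd1] := gradG.
pose S i := exists x, x \in G i /\ x != 0.
have S0 : S 0%N by exists 1; split; [exact: graded1 | exact: oner_neq0].
have SD i j : S i -> S j -> S (i + j)%N.
  move=> [x [xG x0]] [y [yG y0]]; exists (x * y); split; first exact: gradedM.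
  exact: mulf_neq0.
have [|n [n0 [a [aG a0]] [b [bG b0]]]] := consecutive_degrees S0 SD.
  by move=> d h; apply: gcd1 => i [x xG x0]; apply: h; exists x.
pose fr := @FracField.tofrac A; pose z := fr b / fr a.
have fa0 : fr a != 0 by rewrite tofrac_eq0.
(* b ^ n and a ^ (n + 1) are proportional, so z ^ n lies in A. *)
have [||||c ec] := @component_dim1 (n * n.+1)%N (a ^+ n.+1) (b ^+ n).
- by rewrite muln_gt0 n0.
- by rewrite mulnC; apply: gradedX.
- exact: gradedX.
- exact: expf_neq0.
have iz : integralOver fr z.
  exists ('X^n - (sigma c * a)%:P); first exact: monicXnsubC.
  rewrite rmorphB /= map_polyXn map_polyC /root !hornerE subr_eq0 exprMn exprVn -rmorphXn ec.
  have -> : sigma c * a ^+ n.+1 = (sigma c * a) * a ^+ n by rewrite exprS mulrA.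
  by rewrite [X in X / _]rmorphM rmorphXn /= mulfK // expf_neq0.
exists (ic_of iz), (n * n)%N; apply: (@graded_uniformizer n a b) => //.
by apply: ic_frac_inj; rewrite rmorphM /= !ic_frac_to mulrC /ic_frac /= divfK.
Qed.

End WithCoaction.
End GradedRing.

(** * Torsion of graded modules and the decomposition theorem *)

Lemma seq_int_min (s : seq int) : s != [::] -> exists2 j, j \in s & forall i, i \in s -> (j <= i)%R.
Proof.
elim: s => // x s IH _; have [->|/IH [j js hj]] := eqVneq s [::].
  by exists x; rewrite ?inE // => i; rewrite inE => /eqP ->.
have [xj|jx] := boolP (x <= j)%R.
  exists x; rewrite ?mem_head // => i; rewrite inE => /orP[/eqP -> //|/hj].
  by move: xj; lia.
exists j; rewrite ?inE ?js ?orbT // => i; rewrite inE => /orP[/eqP ->|/hj //].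
by move: jx; lia.
Qed.

Section GradedTorsion.
Variables (A : idomainType) (G : nat -> {pred A}) (M : lmodType A) (H : int -> {pred M}).
Hypotheses (gradG : graded_ring G) (gradM : graded_module G H).

(** The product of the lowest components of [a] and [y] is a component of
    [a y = 0], so it vanishes; remove the lowest component of [y] and repeat. *)
Lemma homogeneous_annihilator (y : M) : torsion y ->
  exists d h, [/\ h \in G d, h != 0 & h *: y = 0].
Proof.
have [gamma [gammaG gamma1 gammaH]] := graded_coaction gradG.
have [gH GH] := gradM.
have [pr [[prB prH prE supp] dec]] := grading_projections gH.
have pr0 i : pr i 0 = 0 by rewrite -[X in pr i X](subrr 0) prB subrr.
have prD i u v : pr i (u + v) = pr i u + pr i v.
  by rewrite -{1}[v]opprK prB -[- v]sub0r prB pr0 sub0r opprK.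
have pr_sum i (T : Type) (s : seq T) (F : T -> M) :
    pr i (\sum_(j <- s) F j) = \sum_(j <- s) pr i (F j).
  exact: (big_morph (pr i) (prD i) (pr0 i)).
suff main n : forall (y : M) a s, uniq s -> size s = n -> (forall i, i \notin s -> pr i y = 0) ->
    a != 0 -> a *: y = 0 -> exists d h, [/\ h \in G d, h != 0 & h *: y = 0].
  by move=> [a a0 ay]; have [s [us s0]] := supp y; apply: (main (size s) y a s).
elim: n => [|n IHn] {}y a s us ss s0 a0 ay.
  exists 0%N, 1; split; [exact: graded1 | exact: oner_neq0 |].
  by rewrite (dec y s us s0) (size0nil ss) big_nil scaler0.
have [|j0 j0s minj] := @seq_int_min s; first by case: s ss {us s0}.
have [i0 [ai0 mini]] : exists i, (gamma a)`_i != 0 /\ forall j, (j < i)%N -> (gamma a)`_j = 0.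
  have exi : exists i, (gamma a)`_i != 0.
    exists (size (gamma a)).-1; rewrite -lead_coefE lead_coef_eq0.
    by apply: contraNneq a0 => e; rewrite -[a]gamma1 e horner0.
  case: (ex_minnP exi) => i ai mini; exists i; split=> // j ji.
  by apply/eqP; apply: contraTT ji => /mini; rewrite -leqNgt.
set h0 := (gamma a)`_i0 in ai0.
have e0 : h0 *: pr j0 y = 0.
  have i0s : (i0 < size (gamma a))%N.
    by rewrite ltnNge; apply: contraNN ai0 => h; rewrite /h0 nth_default.
  have : pr (i0%:Z + j0) (a *: y) = h0 *: pr j0 y.
    have prc (i : nat) j : pr (i0%:Z + j0) ((gamma a)`_i *: pr j y) =
        if i0%:Z + j0 == i%:Z + j then (gamma a)`_i *: pr j y else 0.
      by apply: prE; apply: GH.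
    have ea : a = \sum_(i < size (gamma a)) (gamma a)`_i.
      by rewrite -[LHS]gamma1 horner_coef; apply: eq_bigr => i _; rewrite expr1n mulr1.
    rewrite {1}ea {1}(dec y s us s0) scaler_suml pr_sum (bigD1 (Ordinal i0s)) //=.
    rewrite scaler_sumr pr_sum (bigD1_seq j0) //= prc eqxx.
    rewrite big_seq_cond big1 ?addr0 => [|j /andP[_ jj0]]; last first.
      by rewrite prc; case: eqP => // /addrI e; rewrite e eqxx in jj0.
    rewrite big1 ?addr0 // => i ii0; rewrite scaler_sumr pr_sum big_seq big1 // => j js.
    rewrite prc; case: eqP => // e.
    have [ilt|ile] := ltnP i i0; first by rewrite mini ?scale0r.
    have ne : (i != i0 :> nat) by [].
    by have := minj j js; move: e ile ne; clear; lia.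
  by rewrite ay pr0 => <-.
have [||||d [h [hG h0' hy]]] := IHn (y - pr j0 y) (a * h0) (rem j0 s) (rem_uniq _ us).
- by rewrite size_rem // ss.
- move=> i; rewrite mem_rem_uniq // inE negb_and negbK prB (prE _ _ _ (prH j0 y)).
  by case: eqP => [->|_ /s0 ->]; rewrite subrr.
- exact: mulf_neq0.
- by rewrite scalerBr mulrC -scalerA ay scaler0 mulrC -scalerA e0 scaler0 subrr.
exists (d + i0)%N, (h * h0); split; [|exact: mulf_neq0|].
  by apply: (gradedM gradG) => //; apply: gammaG.
rewrite -[y](subrK (pr j0 y)) scalerDr mulrC -scalerA hy scaler0 add0r.
by rewrite mulrC -scalerA e0 scaler0.
Qed.

End GradedTorsion.

Theorem theorem3p1 (p : nat) (A : idomainType) (pcharA : p \in [pchar A])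
    (m : {pred A}) (k : fieldType) (pi : {rmorphism A -> k})
    (M : lmodType A) (r l : nat) :
  noetherian A ->
  krull_dim A 1 ->
  (complete_local m \/
   exists (G : nat -> {pred A}) (H : int -> {pred M}),
     [/\ graded_ring G, m =i irrelevant_ideal G & graded_module G H]) ->
  residue_field m pi ->
  GRing.closed_field_axiom k ->
  fin_gen M ->
  has_rank M r ->
  has_length (H0 m M) l ->
  (exists e0 : nat, forall e : nat, (e0 <= e)%N ->
     lmod_iso (frobenius_module pcharA e M)
       (({ffun 'I_(r * p ^ e) -> integral_closure A}
         * {ffun 'I_l -> residue_module pi})%type : lmodType A)) /\
  FFRT pcharA M.
Proof.
move=> noeA dim1 cases resk closedk fgM rk len.
have [x xm x0] := m_neq0 dim1 resk.
suff [[t [c ut]] torH] : (exists t c, @uniformizer A p m t c) /\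
    forall y : M, torsion y -> y \in H0 m M.
  exact: (frobenius_decomposition pcharA noeA resk closedk ut fgM torH
            (ex_intro2 _ _ x xm x0) rk len).
case: cases => [[local_m complete_m]|[G [H [gradG irr_m gradM]]]].
  split; last by move=> y; apply: (torsion_in_H0 noeA dim1 local_m resk).
  exact: (complete_uniformizer pcharA noeA dim1 local_m complete_m resk closedk xm x0).
have [gamma [gammaG gamma1 gammaH]] := graded_coaction gradG.
have [sigma [sigmaG sigmaK]] := residue_section gradG irr_m resk gammaG gamma1 gammaH.
split.
  exact: (graded_uniformizer_exists gradG noeA dim1 irr_m resk closedk
            gammaG gamma1 gammaH sigmaG sigmaK pcharA).
move=> y /(homogeneous_annihilator gradG gradM) [d [h [hG h0 hy]]].
have [N hN] := graded_pow_in noeA dim1 irr_m resk gammaG gamma1 gammaH hG h0.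
apply/asboolP; exists N => a aN.
have [c ->] := pow_in_ideal_pow (principal_ideal h) hN aN.
by rewrite mulrC -scalerA hy scaler0.
Qed.
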